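(* Let $y=(y_n)_{n\ge 1}$ be an aperiodic sequence (a bounded real-valued sequence with zero average along every infinite arithmetic progression), and let $N\ge 2$ be an integer. Then for every $\epsilon>0$ there exists a strictly ergodic subshift $\Sigma'$ over an alphabet of $N$ symbols whose topological entropy $h(\Sigma')$ satisfies $|h(\Sigma')-\log N|<\epsilon$ and which is uniformly uncorrelated to $y$.
   Context: A bounded real-valued sequence $y=(y_n)_{n\ge1}$ is called aperiodic if for every $t\ge 1$ and $l\ge 0$ one has $\lim_{n\to\infty}\frac1n\sum_{i=1}^n y_{it+l}=0$. Let $\Lambda$ be a finite alphabet with $N$ elements. A subshift over $\Lambda$ is a (nonempty) closed subset $\Sigma\subset\Lambda^{\mathbb N}$ (product topology) which is invariant under the shift $T$, $(Tx)_n=x_{n+1}$; it is regarded as a topological dynamical system with the action of $T$. Topological entropy is taken with the natural logarithm. The subshift is strictly ergodic if it is uniquely ergodic (it carries exactly one $T$-invariant Borel probability measure) and minimal. A subshift $\Sigma$ is uniformly uncorrelated to $y$ if for every continuous function $f:\Sigma\to\mathbb R$ one has $\lim_{n\to\infty}\frac1n\sum_{i=1}^n f(T^ix)\,y_i=0$ uniformly in $x\in\Sigma$, i.e., for every continuous $f$ and every $\epsilon>0$ there is $n_0$ such that $\left|\frac1n\sum_{i=1}^{n}f(T^ix)\,y_i\right|<\epsilon$ for all $n\ge n_0$ and all $x\in\Sigma$. *)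

(* Defs.v *)
From HB Require Import structures.
From mathcomp Require Import all_boot all_order all_algebra.
From mathcomp Require Import all_classical all_reals all_analysis.

Set Implicit Arguments.
Unset Strict Implicit.
Unset Printing Implicit Defensive.

Import Order.TTheory GRing.Theory Num.Theory.
Import numFieldNormedType.Exports.

Local Open Scope classical_set_scope.
Local Open Scope ring_scope.

(* Sequences (y_n)_{n >= 1} are functions on nat whose value at 0 is never
   used. *)
Definition aperiodic (R : realType) (y : nat -> R) : Prop :=
  (exists M : R, forall n, (1 <= n)%N -> `|y n| <= M) /\
  (forall t l : nat, (1 <= t)%N ->
     n%:R^-1 * (\sum_(1 <= i < n.+1) y (i * t + l)%N) @[n --> \oo] --> (0 : R)).

Section dynamics.
Variables (R : realType) (X : ptopologicalType) (T : X -> X).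

Local Notation borel := (g_sigma_algebraType (@open X)).

Definition invariant_probability (mu : probability borel R) : Prop :=
  forall A : set borel, measurable A -> mu (T @^-1` A) = mu A.

(* A measure of the library is a function on all sets, whose values outside
   the sigma-algebra are irrelevant: uniqueness is up to those values. *)
Definition uniquely_ergodic : Prop :=
  exists2 mu : probability borel R, invariant_probability mu &
    forall nu : probability borel R, invariant_probability nu ->
      forall A : set borel, measurable A -> nu A = mu A.

Definition minimal_system : Prop :=
  forall F : set X, closed F -> F !=set0 -> T @` F `<=` F -> F = setT.

Definition strictly_ergodic : Prop := uniquely_ergodic /\ minimal_system.

(* Topological entropy of Adler, Konheim and McAndrew; X is meant to be
   compact and T continuous. *)
Definition open_cover (U : set (set X)) : Prop :=
  (forall A, U A -> open A) /\ \bigcup_(A in U) A = setT.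

(* The join of U, T^-1 U, ..., T^-(n-1) U. *)
Definition iterated_join (U : set (set X)) (n : nat) : set (set X) :=
  [set \bigcap_(i < n) (iter i T @^-1` w i)
     | w in [set w : nat -> set X | forall i, U (w i)]].

(* The infimum is over a set of natural numbers, which is nonempty when X is
   compact and U is an open cover, so it is a minimum. *)
Definition covering_number (U : set (set X)) : R :=
  inf [set k%:R | k in
         [set k : nat | exists V : set (set X),
            [/\ V `<=` U, (V #= `I_k)%card & \bigcup_(A in V) A = setT]]].

(* By subadditivity the limit exists for every open cover U. *)
Definition cover_entropy (U : set (set X)) : R :=
  lim ((fun n => n%:R^-1 * ln (covering_number (iterated_join U n))) @ \oo).

Definition topological_entropy : \bar R :=
  ereal_sup [set (cover_entropy U)%:E | U in open_cover].

Definition uniformly_uncorrelated (y : nat -> R) : Prop :=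
  forall f : X -> R, continuous f ->
  forall e : R, 0 < e -> exists n0 : nat, forall n : nat, (n0 <= n)%N ->
  forall x : X, `|n%:R^-1 * \sum_(1 <= i < n.+1) f (iter i T x) * y i| < e.

End dynamics.

Definition full_shift (L : finType) : Type := {ptws nat -> discrete_topology L}.
HB.instance Definition _ (L : finType) := Topological.on (full_shift L).

Definition shift_map (L : finType) (x : full_shift L) : full_shift L :=
  fun n => x n.+1.

Record subshift (L : finType) := Subshift {
  subshift_set :> set (full_shift L);
  subshift_neq0 : subshift_set !=set0;
  subshift_closed : closed subshift_set;
  subshift_invariant : @shift_map L @` subshift_set `<=` subshift_set }.

(* A subshift as a space in its own right, with the subspace topology. *)
Section subshift_space.
Variables (L : finType) (S : subshift L).

Definition subshift_space : Type := set_type (subshift_set S).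
HB.instance Definition _ := Topological.on subshift_space.

Fact subshift_space_inhabited : exists x : subshift_space, True.
Proof. by have [x Sx] := subshift_neq0 S; exists (exist _ x (mem_set Sx)). Qed.
(* Measurable types have to be pointed; the point itself is arbitrary. *)
HB.instance Definition _ :=
  isPointed.Build subshift_space (sval (cid subshift_space_inhabited)).

Fact shift_subproof (x : subshift_space) : shift_map (\val x) \in (S : set _).
Proof.
by apply/mem_set/subshift_invariant; exists (\val x) => //; exact: set_valP.
Qed.

Definition subshift_map (x : subshift_space) : subshift_space :=
  exist _ (shift_map (\val x)) (shift_subproof x).

End subshift_space.

(* Main.v *)
(* Blocks of length l_k = u_k^4, with u_k = u_0^(2^k), are built inductively:
   a (k+1)-block is a concatenation of l_k blocks of level k that is typical,
   i.e. whose deviation from the mean, tested against the occurrences of the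
   first u_k words and weighted by the constant 1 or by y read at any offset
   smaller than u_k^32 = l_(k+3), is at most l_(k+1) / u_k. By Chernoff's bound
   all but a proportion 1/u_k of the concatenations are typical; hence the
   entropy stays within 2 / u_0 of log N, and the mean occurrence profile of a
   word along the k-blocks, an l_k-periodic sequence, changes by at most
   2 / u_k from one level to the next. Along every long factor of a block, the
   occurrences of a word thus behave like a fixed periodic sequence, up to a
   small proportion: against the weight 1 this yields a uniform frequency, and
   against y it yields 0 by aperiodicity.

   The subshift consists of the sequences all of whose factors have positive
   frequency. Positivity gives minimality, uniformity gives unique ergodicity,
   and the invariant measure is the image of the uniform distribution on [0, 1]
   under the coding by nested intervals whose lengths are the frequencies. The
   positive words of length l_k are at least a quarter of the k-blocks, because
   a given k-block has probability at most 2 / b_k at every aligned position of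
   a random block of higher level, where b_k is the number of k-blocks. *)
Require Import Defs.
From HB Require Import structures.
From mathcomp Require Import all_boot all_order all_algebra.
From mathcomp Require Import all_classical all_reals all_analysis.
From mathcomp Require Import measurable_realfun ring lra zify.
Import Order.TTheory GRing.Theory Num.Theory.
Import numFieldNormedType.Exports.

Set Implicit Arguments.
Unset Strict Implicit.
Unset Printing Implicit Defensive.

Local Open Scope ring_scope.

(** * Exponential concentration *)

(** Two obstacles shape the parameters. Aperiodicity comes without a rate, so [y] can be averaged
    only against one fixed period [len k], whereas typicality controls a factor of length n at a
    level that grows with n; the profiles at the two levels differ by at most [4 / scale k], which
    bridges the gap. Moreover, correlations must be small from every starting point, so a block has
    to be tested against [y] read at every offset at which it can sit in a factor. A factor with
    [len k.+2 <= n < len k.+3] is cut into blocks of level [k.+1]: the offsets stay below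
    [len k.+3], and the incomplete blocks at both ends are negligible beside
    [len k.+2 = len k.+1 ^ 2]. So 2 u^33 tests suffice at level k, where u = [scale k]. The
    exponents make them affordable: a block of level [k.+1] has u^4 independent constituents, each
    contributing at most M u^4 to a sum in which a deviation of u^7 is tolerated. Chernoff's
    exponent is then of order u^2 / M^2, and its exponential exceeds every power of u. *)

Section Concentration.
Variable R : realType.

(** As [expR (- x) >= 1 - x], it suffices that (1 - x)(1 + x + 2 x^2) = 1 + x^2 (1 - 2 x) >= 1. *)
Lemma expR_le_quadratic (x : R) : `|x| <= 2^-1 -> expR x <= 1 + x + 2 * x ^+ 2.
Proof.
rewrite ler_norml => /andP[x1 x2].
have h : 0 < 1 - x by lra.
have e : expR x <= (1 - x)^-1.
  rewrite -[expR x]invrK lef_pV2 ?posrE ?invr_gt0 ?expR_gt0 //.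
  by rewrite -expRN; have := expR_ge1Dx (- x).
apply: (le_trans e).
rewrite -[_^-1]mul1r ler_pdivrMr //.
nra.
Qed.

(** Markov's inequality for the exponential moment, by counting: the sum over all [f] of a product
    is the product of the sums over [x]. In each factor the linear term vanishes because [c i] is
    centred, which leaves at most [#|I|] times 1 + 2 tau^2. *)
Lemma chernoff_upper (I : finType) (q : nat) (c : 'I_q -> I -> R) (tau a : R) :
  0 <= tau <= 2^-1 -> (forall i x, `|c i x| <= 1) ->
  (forall i, \sum_x c i x = 0) ->
  #|[pred f : {ffun 'I_q -> I} | a <= \sum_i c i (f i)]|%:R * expR (tau * a)
    <= #|I|%:R ^+ q * expR (2 * q%:R * tau ^+ 2).
Proof.
move=> /andP[t0 t1] c1 c0.
apply: (@le_trans _ _ (\sum_(f : {ffun 'I_q -> I}) \prod_i expR (tau * c i (f i)))).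
  rewrite -sum1_card natr_sum mulr_suml big_mkcond /=; apply: ler_sum => f _.
  rewrite -expR_sum -mulr_sumr; case: ifP => [h|_]; last exact: expR_ge0.
  by rewrite mul1r ler_expR ler_wpM2l.
rewrite -(bigA_distr_bigA (fun i x => expR (tau * c i x))) /=.
apply: (@le_trans _ _ (\prod_(i < q) (#|I|%:R * expR (2 * tau ^+ 2)))); last first.
  rewrite prodr_const card_ord exprMn -expRM_natl.
  by have -> : q%:R * (2 * tau ^+ 2) = 2 * q%:R * tau ^+ 2 by ring.
apply: ler_prod => i _; apply/andP; split; first by apply: sumr_ge0 => *; exact: expR_ge0.
apply: (@le_trans _ _ (\sum_x (1 + tau * c i x + 2 * tau ^+ 2))).
  apply: ler_sum => x _; have := c1 i x; rewrite ler_norml => /andP[a1 a2].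
  apply: (le_trans (expR_le_quadratic _)).
    by rewrite normrM ger0_norm // -[2^-1]mulr1 ler_pM.
  rewrite lerD2l exprMn; apply: ler_wpM2l => //.
  rewrite -[leRHS]mulr1 ler_wpM2l ?sqr_ge0 // expr2; nra.
under eq_bigr do rewrite addrAC.
rewrite big_split /= -mulr_sumr c0 mulr0 addr0 sumr_const -[leLHS]mulr_natl.
by apply: ler_wpM2l => //; exact: expR_ge1Dx.
Qed.

Lemma chernoff (I : finType) (q : nat) (c : 'I_q -> I -> R) (tau a : R) :
  0 <= tau <= 2^-1 -> (forall i x, `|c i x| <= 1) ->
  (forall i, \sum_x c i x = 0) ->
  #|[pred f : {ffun 'I_q -> I} | a <= `|\sum_i c i (f i)|]|%:R * expR (tau * a)
    <= 2 * (#|I|%:R ^+ q * expR (2 * q%:R * tau ^+ 2)).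
Proof.
move=> ht c1 c0.
have h1 := @chernoff_upper I q c tau a ht c1 c0.
have h2 : #|[pred f : {ffun 'I_q -> I} | a <= \sum_i (- c i (f i))]|%:R * expR (tau * a)
    <= #|I|%:R ^+ q * expR (2 * q%:R * tau ^+ 2).
  apply: (@chernoff_upper I q (fun i x => - c i x)) => // [i x|i].
    by rewrite normrN.
  by rewrite sumrN c0 oppr0.
rewrite [2]mulr2n mulrDl mul1r; apply: le_trans (lerD h1 h2).
rewrite -mulrDl ler_wpM2r ?expR_ge0 // -natrD ler_nat.
rewrite -cardUI; apply: leq_trans (leq_addr _ _).
apply: subset_leq_card; apply/fintype.subsetP => f; rewrite !inE sumrN.
by rewrite lter_normr.
Qed.

(* From e^x >= (x / 18)^18. *)
Lemma expR_sq_ge_pow (c : R) : 0 < c ->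
  exists U : nat, forall v : nat, (U <= v)%N -> 4 * v%:R ^+ 34 <= expR (c * v%:R ^+ 2).
Proof.
move=> c0; pose D := 4 * (18 / c) ^+ 18.
have D0 : 0 <= D by rewrite mulr_ge0 // exprn_ge0 // divr_ge0 // ltW.
exists (Num.truncn D).+1 => v hv.
have v1 : (1 <= v)%N by apply: leq_trans hv.
have vD : D <= v%:R by apply: (le_trans (ltW (truncnS_gt D))); rewrite ler_nat.
have e : c * v%:R ^+ 2 = 18%:R * (c * v%:R ^+ 2 / 18) :> R by field.
rewrite e expRM_natl; apply: (@le_trans _ _ ((c * v%:R ^+ 2 / 18) ^+ 18)); last first.
  rewrite lerXn2r ?nnegrE ?expR_ge0 //.
    by rewrite divr_ge0 // mulr_ge0 ?exprn_ge0 // ltW.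
  by apply: le_trans (expR_ge1Dx _); rewrite lerDr.
have -> : (c * v%:R ^+ 2 / 18) ^+ 18 = (c / 18) ^+ 18 * v%:R ^+ 2 * v%:R ^+ 34 :> R.
  rewrite mulrAC exprMn -mulrA -exprM -exprD //.
rewrite ler_wpM2r ?exprn_ge0 //.
have -> : 4 = (c / 18) ^+ 18 * D :> R.
  rewrite /D mulrCA -exprMn.
  have -> : c / 18 * (18 / c) = 1 :> R by field; rewrite gt_eqF.
  by rewrite expr1n mulr1.
rewrite ler_wpM2l //; first by rewrite exprn_ge0 // divr_ge0 // ltW.
apply: (le_trans vD); by rewrite -natrX ler_nat -mulnn leq_pmulr.
Qed.

End Concentration.

(** * Typical concatenations of blocks *)

Lemma le_of_eq (d : Order.disp_t) (T : porderType d) (x y : T) : x = y -> (x <= y)%O.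
Proof. by move=> ->. Qed.

Section Step.
Variables (R : realType) (A : finType).
Implicit Types (w X : seq A) (B : seq (seq A)).

Definition occurs w X (p : nat) : bool := take (size w) (drop p X) == w.

(* Only occurrences inside one of the consecutive windows of length [l] count:
   when [l] is the length of an earlier block, these tests do not see the
   boundaries between later blocks. *)
Definition aligned_occurs (l : nat) w X (p : nat) : bool :=
  occurs w X p && (p %% l + size w <= l)%N.

(** Through [pickle], [t] numbers the pairs (window length, word), so that each pair is tested at
    all levels with [t < scale k]. *)
Definition test (t : nat) X (p : nat) : R :=
  if unpickle t is Some (l, w) then (aligned_occurs l w X p)%:R else 0.

Lemma test_itv01 t X p : 0 <= test t X p <= 1.
Proof.
rewrite /test; case: unpickle => [[l w]|]; last by rewrite lexx ler01.
by case: aligned_occurs; rewrite ?lexx ler01.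
Qed.

Definition avg B (F : seq A -> R) : R := (\sum_(b <- B) F b) / (size B)%:R.

Definition pick_block B q (f : {ffun 'I_q -> 'I_(size B)}) (i : 'I_q) : seq A :=
  tnth (in_tuple B) (f i).

(** The mean is subtracted position by position inside a block because [z] varies along it; this
    centres each of the [q] independent summands exactly. *)
Definition dev (g : seq A -> nat -> R) (z : nat -> R) B q l j
    (f : {ffun 'I_q -> 'I_(size B)}) : R :=
  \sum_(i < q) \sum_(r < l)
    z (j + (i * l + r))%N * (g (pick_block f i) r - avg B (g^~ r)).

Lemma sum_blockE B (F : seq A -> R) :
  \sum_(i < size B) F (tnth (in_tuple B) i) = \sum_(b <- B) F b.
Proof. by rewrite [RHS]big_tnth. Qed.

Lemma avg_itv01 B F : (forall b, 0 <= F b <= 1) -> 0 <= avg B F <= 1.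
Proof.
move=> h; rewrite /avg; case: (posnP (size B)) => [->|b0].
  by rewrite invr0 mulr0 lexx ler01.
apply/andP; split.
  by rewrite divr_ge0 // sumr_ge0 // => b _; case/andP: (h b).
rewrite ler_pdivrMr ?ltr0n // mul1r -sum1_size natr_sum.
by apply: ler_sum => b _; case/andP: (h b).
Qed.

Variable M : R.
Hypothesis M1 : 1 <= M.

Lemma dev_rare (g : seq A -> nat -> R) (z : nat -> R) B v j :
  (forall n, `|z n| <= M) -> (forall X p, 0 <= g X p <= 1) -> (0 < v)%N ->
  (0 < size B)%N ->
  #|[pred f : {ffun 'I_(v ^ 4) -> 'I_(size B)} |
      v%:R ^+ 7 <= `|dev g z (v ^ 4) j f| ]|%:R
   * expR ((8 * M ^+ 2)^-1 * v%:R ^+ 2) <= 2 * (size B)%:R ^+ (v ^ 4).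
Proof.
move=> hz hg v0 b0.
have M0 : 0 < M by apply: lt_le_trans M1.
have vR : 0 < v%:R :> R by rewrite ltr0n.
have v1 : 1 <= v%:R :> R by rewrite ler1n.
have q0 : 0 < (v ^ 4)%:R :> R by rewrite ltr0n expn_gt0 v0.
(* The contribution of the i-th constituent, scaled to be at most 1. *)
pose c (i : 'I_(v ^ 4)) (x : 'I_(size B)) : R :=
  (\sum_(r < v ^ 4) z (j + (i * v ^ 4 + r))%N *
     (g (tnth (in_tuple B) x) r - avg B (g^~ r))) / (M * (v ^ 4)%:R).
have Mq0 : 0 < M * (v ^ 4)%:R by rewrite mulr_gt0.
have c1 i x : `|c i x| <= 1.
  rewrite /c normrM normfV (gtr0_norm Mq0) ler_pdivrMr // mul1r.
  apply: (le_trans (ler_norm_sum _ _ _)).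
  have -> : M * (v ^ 4)%:R = \sum_(r < v ^ 4) M by rewrite sumr_const card_ord mulr_natr.
  apply: ler_sum => r _; rewrite normrM -[leRHS]mulr1 ler_pM //.
  have /andP[a1 a2] := hg (tnth (in_tuple B) x) r.
  have /andP[a3 a4] := avg_itv01 B (fun b => hg b r).
  by rewrite ler_norml; apply/andP; split; lra.
have c0 i : \sum_x c i x = 0.
  rewrite /c -mulr_suml exchange_big /= big1 ?mul0r // => r _.
  rewrite -mulr_sumr sumrB (sum_blockE B (g^~ r)) sumr_const card_ord /avg.
  by rewrite -[_ *+ size B]mulr_natr divfK ?subrr ?mulr0 // pnatr_eq0 -lt0n.
(* For [q = v ^ 4] summands and the scaled threshold [a = v ^ 3 / M], this is the minimiser a / (4
   q) of 2 q tau^2 - tau a. With the [E] set below, tau a = 2 E and 2 q tau^2 = E. *)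
have tau1 : 0 <= (4 * v%:R * M)^-1 <= 2^-1.
  apply/andP; split; first by rewrite invr_ge0 !mulr_ge0 // ltW.
  rewrite lef_pV2 ?posrE //; last by rewrite !mulr_gt0.
  have : 1 <= v%:R * M by apply: mulr_ege1.
  by rewrite -mulrA; lra.
have := chernoff (v%:R ^+ 3 / M) tau1 c1 c0.
rewrite card_ord.
have e1 : (4 * v%:R * M)^-1 * (v%:R ^+ 3 / M) = 2 * ((8 * M ^+ 2)^-1 * v%:R ^+ 2) :> R.
  by field; rewrite !gt_eqF.
have e2 : 2 * (v ^ 4)%:R * (4 * v%:R * M)^-1 ^+ 2 = (8 * M ^+ 2)^-1 * v%:R ^+ 2 :> R.
  by rewrite natrX; field; rewrite !gt_eqF.
rewrite e1 e2; set E := (8 * M ^+ 2)^-1 * v%:R ^+ 2.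
move=> h; rewrite -(ler_pM2r (expR_gt0 E)) -!mulrA -expRD -[E + E]mulr2n -[E *+ 2]mulr_natl.
apply: le_trans h; apply: le_of_eq.
congr (_%:R * _); apply: eq_card => f; rewrite !inE.
rewrite /c -mulr_suml normrM normfV (gtr0_norm Mq0) ler_pdivlMr //.
by congr (_ <= _); rewrite natrX; field; rewrite gt_eqF.
Qed.

Variable z : bool -> nat -> R.
Hypothesis zM : forall e n, `|z e n| <= M.

Definition typical v B (f : {ffun 'I_(v ^ 4) -> 'I_(size B)}) : bool :=
  [forall t : 'I_v, forall j : 'I_(v ^ 32), forall e : bool,
     `|dev (test t) (z e) (v ^ 4) j f| <= v%:R ^+ 7].

(** Union bound. The number 4 v^34 is made of the 2 v^33 tests, a factor 2 for the two tails of
    Chernoff's bound, and a factor v for the proportion 1 / v aimed at. *)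
Lemma typical_frequent v B : (0 < v)%N -> (0 < size B)%N ->
  4 * v%:R ^+ 34 <= expR ((8 * M ^+ 2)^-1 * v%:R ^+ 2) ->
  #|[pred f | ~~ @typical v B f]|%:R * v%:R <= (size B)%:R ^+ (v ^ 4) :> R.
Proof.
move=> v0 b0 hv; set E := expR _ in hv.
have E0 : 0 < E by exact: expR_gt0.
have vR : 0 < v%:R :> R by rewrite ltr0n.
pose bad (p : 'I_v * 'I_(v ^ 32) * bool) :=
  [set f : {ffun 'I_(v ^ 4) -> 'I_(size B)} |
    v%:R ^+ 7 <= `|dev (test p.1.1) (z p.2) (v ^ 4) p.1.2 f|].
have hbad p : #|bad p|%:R * E <= 2 * (size B)%:R ^+ (v ^ 4).
  have := dev_rare p.1.2 (zM p.2) (test_itv01 p.1.1) v0 b0.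
  by rewrite -/E /bad cardsE.
have sub : (#|[pred f | ~~ @typical v B f]| <= \sum_p #|bad p|)%N.
  apply: (@leq_trans #|\bigcup_p bad p|); last first.
    apply: (big_ind2 (fun (S : {set _}) n => (#|S| <= n)%N)); rewrite ?cards0 //.
    by move=> S1 n1 S2 n2 h1 h2; apply: leq_trans (leq_card_setU _ _).1 (leq_add h1 h2).
  apply/subset_leq_card/fintype.subsetP => f; rewrite inE.
  move=> /forallPn[t /forallPn[j /forallPn[e h]]].
  apply/bigcupP; exists ((t, j), e) => //; rewrite inE /= ltW //.
  by rewrite ltNge.
rewrite -(ler_pM2r E0).
apply: (@le_trans _ _ ((\sum_p #|bad p|)%:R * v%:R * E)).
  by rewrite ler_pM2r // ler_pM2r // ler_nat.
rewrite mulrAC natr_sum mulr_suml.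
apply: (@le_trans _ _
  ((\sum_(p : 'I_v * 'I_(v ^ 32) * bool) 2 * (size B)%:R ^+ (v ^ 4)) * v%:R)).
  by rewrite ler_pM2r //; apply: ler_sum.
rewrite sumr_const !card_prod !card_ord card_bool.
rewrite [leLHS]mulrC [leRHS]mulrC; apply: le_trans (ler_wpM2r (exprn_ge0 _ _) hv) => //.
rewrite -[(_ * _) *+ _]mulr_natl (natrM _ (v * v ^ 32)%N 2%N) (natrM _ v (v ^ 32)%N).
by rewrite natrX; apply: le_of_eq; ring.
Qed.

End Step.

(** * Concatenations of words of equal length *)

Section Flatten.
Variable A : finType.
Implicit Types (w X : seq A) (ws : seq (seq A)).

Lemma size_flatten_const l ws : all (fun b => size b == l) ws ->
  size (flatten ws) = (size ws * l)%N.
Proof.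
elim: ws => [//|b ws IH] /= /andP[/eqP h1 h2].
by rewrite size_cat h1 (IH h2) mulSn.
Qed.

Lemma drop_flatten_const l ws i : all (fun b => size b == l) ws ->
  drop (i * l) (flatten ws) = flatten (drop i ws).
Proof.
elim: ws i => [|b ws IH] [|i] //= /andP[/eqP h1 h2].
  by rewrite mul0n drop0.
by rewrite mulSn drop_cat h1 ltnNge leq_addr /= addKn IH.
Qed.

Lemma aligned_occurs_flatten l l' w ws i r :
  all (fun b => size b == l) ws -> (i < size ws)%N -> (r < l)%N -> (l' %| l)%N ->
  aligned_occurs l' w (flatten ws) (i * l + r) = aligned_occurs l' w (nth [::] ws i) r.
Proof.
move=> hl hi hr hd; rewrite /aligned_occurs.
have -> : ((i * l + r) %% l' = r %% l')%N.
  by rewrite -modnDml; have /eqP -> := dvdn_mull i hd.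
case: leqP; rewrite ?andbF // ?andbT => hs.
have hb : size (nth [::] ws i) = l by apply/eqP/(all_nthP _ hl).
rewrite /occurs addnC -drop_drop (drop_flatten_const _ hl) (drop_nth [::] hi) /=.
rewrite drop_cat hb hr take_cat size_drop hb.
(* The window of length [l'] that contains [r] ends at a multiple of [l'], hence not after [l],
   which is itself a multiple. *)
have h : (r + size w <= l)%N.
  have l'0 : (0 < l')%N by case: (posnP l') hd hr => [->|//]; rewrite dvd0n => /eqP ->.
  have -> : (l = l %/ l' * l')%N by rewrite divnK.
  rewrite (divn_eq r l') -addnA (leq_trans (leq_add (leqnn _) hs)) // addnC -mulSn.
  by rewrite leq_mul2r ltn_divLR // divnK // hr orbT.
case: ltnP => h2 //.
have -> : (size w = l - r)%N by lia.
by rewrite subnn take0 cats0 take_oversize // size_drop hb.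
Qed.

End Flatten.

(** * Averages over the typical concatenations *)

Section Averages.
Variables (R : realType) (A : finType).
Implicit Types (B : seq (seq A)).

Definition cat_blocks B q (f : {ffun 'I_q -> 'I_(size B)}) : seq A :=
  flatten [seq pick_block f i | i <- enum 'I_q].

(** A coordinate of a uniformly random [f] is uniform. The factor [size B] on the left avoids the
    exponent [q.-1]. *)
Lemma sum_marginal B q (h : seq A -> R) (i0 : 'I_q) :
  (\sum_(f : {ffun 'I_q -> 'I_(size B)}) h (pick_block f i0)) * (size B)%:R
   = (\sum_(b <- B) h b) * (size B)%:R ^+ q.
Proof.
pose G (i : 'I_q) (x : 'I_(size B)) : R := if i == i0 then h (tnth (in_tuple B) x) else 1.
have e (f : {ffun 'I_q -> 'I_(size B)}) : h (pick_block f i0) = \prod_i G i (f i).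
  rewrite (bigD1 i0) //= /G eqxx big1 ?mulr1 // => i /negbTE -> //.
rewrite (eq_bigr _ (fun f _ => e f)) -(bigA_distr_bigA G) (bigD1 i0) //=.
rewrite /G eqxx (sum_blockE B h) -!mulrA; congr (_ * _).
under eq_bigr => i /negbTE ->.
  rewrite sumr_const card_ord; over.
rewrite prodr_const -exprSr; congr (_ ^+ _).
by rewrite cardC1 card_ord prednK // (leq_trans _ (ltn_ord i0)).
Qed.

Lemma card_ffunR B q : (#|{ffun 'I_q -> 'I_(size B)}|)%:R = (size B)%:R ^+ q :> R.
Proof. by rewrite card_ffun !card_ord natrX. Qed.

Variables (z : bool -> nat -> R).

Definition step v B : seq (seq A) :=
  [seq @cat_blocks B (v ^ 4) f | f <- enum {ffun 'I_(v ^ 4) -> 'I_(size B)} &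
     typical z f].

Lemma sum_step v B (F : seq A -> R) :
  \sum_(b <- step v B) F b = \sum_(f | @typical R A z v B f) F (cat_blocks f).
Proof. by rewrite /step big_map big_filter big_enum_cond /=. Qed.

Lemma size_step v B : size (step v B) = #|[pred f | @typical R A z v B f]|.
Proof.
by rewrite -sum1_size -sum1_card /step big_map big_filter big_enum_cond.
Qed.

Section Subset.
Variables (I : finType) (P : pred I) (F : I -> R) (eta : R).
Hypothesis F01 : forall i, 0 <= F i <= 1.
Hypothesis eta12 : 0 <= eta <= 2^-1.
Hypothesis cardP : (1 - eta) * #|I|%:R <= #|[pred i | P i]|%:R.
Hypothesis I0 : (0 < #|I|)%N.

(** The multiplicative form serves for means as small as the inverse of a number of blocks, about
    which the additive bound of [sub_mean_close] says nothing. *)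
Lemma sub_mean_le : (\sum_(i | P i) F i) / #|[pred i | P i]|%:R
  <= (1 - eta)^-1 * ((\sum_i F i) / #|I|%:R).
Proof.
have /andP[e0 e1] := eta12.
have I0R : 0 < #|I|%:R :> R by rewrite ltr0n.
have P0 : 0 < #|[pred i | P i]|%:R :> R.
  by apply: lt_le_trans cardP; rewrite mulr_gt0 //; lra.
have h : \sum_(i | P i) F i <= \sum_i F i.
  by rewrite big_mkcond; apply: ler_sum => i _; case: (P i) => //; case/andP: (F01 i).
rewrite ler_pdivrMr //; apply: (le_trans h).
have s0 : 0 <= \sum_i F i by apply: sumr_ge0 => i _; case/andP: (F01 i).
have -> : (1 - eta)^-1 * ((\sum_i F i) / #|I|%:R) * #|[pred i | P i]|%:R
  = (\sum_i F i) * (#|[pred i | P i]|%:R / ((1 - eta) * #|I|%:R)).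
  field; apply/andP; split; rewrite gt_eqF //; lra.
rewrite ler_peMr // ler_pdivlMr ?mul1r // mulr_gt0 //; lra.
Qed.

Lemma sub_mean_close :
  `|(\sum_(i | P i) F i) / #|[pred i | P i]|%:R - (\sum_i F i) / #|I|%:R| <= 2 * eta.
Proof.
have /andP[e0 e1] := eta12.
have I0R : 0 < #|I|%:R :> R by rewrite ltr0n.
have P0 : 0 < #|[pred i | P i]|%:R :> R.
  by apply: lt_le_trans cardP; rewrite mulr_gt0 //; lra.
have := sub_mean_le.
have s1 : (\sum_i F i) / #|I|%:R <= 1.
  rewrite ler_pdivrMr // mul1r -sum1_card natr_sum.
  by apply: ler_sum => i _; case/andP: (F01 i).
have s0 : 0 <= (\sum_i F i) / #|I|%:R.
  by rewrite divr_ge0 // sumr_ge0 // => i _; case/andP: (F01 i).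
set a := _ / #|I|%:R in s0 s1 *; set c := _ / #|[pred i | P i]|%:R => h1.
have h2 : a - eta <= c.
  apply: (@le_trans _ _ ((\sum_(i | P i) F i) / #|I|%:R)); last first.
    rewrite ler_wpM2l //; first by apply: sumr_ge0 => i _; case/andP: (F01 i).
    by rewrite lef_pV2 ?posrE // ler_nat max_card.
  rewrite lerBlDr -[eta](mulfK (lt0r_neq0 I0R)).
  rewrite -mulrDl /a ler_wpM2r // ?invr_ge0 ?ler0n //.
  rewrite (bigID P) /= lerD2l.
  apply: (@le_trans _ _ #|[pred i | ~~ P i]|%:R).
    rewrite -sum1_card natr_sum; apply: ler_sum => i _; by case/andP: (F01 i).
  have := cardC [pred i | P i]; rewrite -[X in _ = X]/(#|I|) => e.
  move: cardP; rewrite -e natrD.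
  have -> : #|[predC [pred i | P i]]| = #|[pred i | ~~ P i]| by apply: eq_card.
  lra.
rewrite ler_norml; apply/andP; split; first by lra.
have : (1 - eta)^-1 * a <= a + 2 * eta.
  rewrite mulrC ler_pdivrMr; last by lra.
  nra.
lra.
Qed.

End Subset.

Section StepAverage.
Variables (v : nat) (B : seq (seq A)).
Hypothesis v2 : (2 <= v)%N.
Hypothesis B0 : (0 < size B)%N.
Hypothesis many : #|[pred f | ~~ @typical R A z v B f]|%:R * v%:R
  <= (size B)%:R ^+ (v ^ 4) :> R.
Let eta : R := v%:R^-1.

Let eta12 : 0 <= eta <= 2^-1.
Proof.
by rewrite /eta invr_ge0 ler0n /= lef_pV2 ?posrE ?ltr0n ?(ler_nat _ 2) // (leq_trans _ v2).
Qed.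

Lemma size_step_ge : (1 - v%:R^-1) * (size B)%:R ^+ (v ^ 4) <= (size (step v B))%:R :> R.
Proof.
have v0 : 0 < v%:R :> R by rewrite ltr0n (leq_trans _ v2).
rewrite size_step -(card_ffunR B (v ^ 4)).
have e := cardC [pred f | @typical R A z v B f].
rewrite -[X in _ = X]/(#|{ffun 'I_(v ^ 4) -> 'I_(size B)}|) in e.
move: many; rewrite -ler_pdivlMr // -card_ffunR -e natrD.
have -> : #|[predC [pred f | @typical R A z v B f]]| = #|[pred f | ~~ @typical R A z v B f]|.
  by apply: eq_card.
lra.
Qed.

Variables (F h : seq A -> R) (i0 : 'I_(v ^ 4)).
Hypothesis h01 : forall b, 0 <= h b <= 1.
Hypothesis Fh : forall f : {ffun 'I_(v ^ 4) -> 'I_(size B)},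
  F (cat_blocks f) = h (pick_block f i0).

Let mean_h : (\sum_(f : {ffun 'I_(v ^ 4) -> 'I_(size B)}) h (pick_block f i0)) /
  #|{ffun 'I_(v ^ 4) -> 'I_(size B)}|%:R = avg B h.
Proof.
have b0 : (size B)%:R != 0 :> R by rewrite pnatr_eq0 -lt0n.
rewrite card_ffunR /avg; apply: (canLR (mulfK _)); first by rewrite expf_neq0.
by rewrite mulrAC; apply: (canRL (mulfK b0)); rewrite sum_marginal.
Qed.

Let avg_stepE : avg (step v B) F =
  (\sum_(f | @typical R A z v B f) h (pick_block f i0)) / #|[pred f | @typical R A z v B f]|%:R.
Proof.
by rewrite /avg sum_step size_step; congr (_ / _); apply: eq_bigr.
Qed.

Let cardI : (0 < #|{ffun 'I_(v ^ 4) -> 'I_(size B)}|)%N.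
Proof. by rewrite card_ffun !card_ord expn_gt0 B0. Qed.

Let cardP : (1 - eta) * #|{ffun 'I_(v ^ 4) -> 'I_(size B)}|%:R <=
  #|[pred f | @typical R A z v B f]|%:R.
Proof. by rewrite card_ffunR -size_step; exact: size_step_ge. Qed.

(** [F] reads a single constituent of the concatenation, so its mean over all concatenations is the
    mean of [h] over [B]; restricting to the typical ones costs [2 / v]. *)
Lemma avg_step_close : `|avg (step v B) F - avg B h| <= 2 / v%:R.
Proof.
by rewrite avg_stepE -mean_h; apply: (sub_mean_close _ eta12 cardP cardI).
Qed.

Lemma avg_step_le : avg (step v B) F <= (1 - v%:R^-1)^-1 * avg B h.
Proof.
by rewrite avg_stepE -mean_h; apply: (sub_mean_le _ eta12 cardP cardI).
Qed.

End StepAverage.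
End Averages.

(** * The hierarchy of blocks *)

(** The shift by [m] is for a factor starting at position [m] of a block: its index [i] is position
    [m + i], and the cuts are at positions that are multiples of [L]. *)
Lemma sum_chunks (V : zmodType) (F : nat -> V) L m a c : (m <= a * L)%N -> (a <= c)%N ->
  \sum_(a * L - m <= i < c * L - m) F i =
  \sum_(a <= h < c) \sum_(r < L) F (h * L - m + r)%N.
Proof.
move=> ma; elim: c => [|c IH].
  by rewrite leqn0 => /eqP ->; rewrite !big_geq.
rewrite leq_eqVlt => /predU1P[<-|ac]; first by rewrite !big_geq.
have aL : (a * L <= c * L)%N by rewrite leq_mul2r (ltnSE ac) orbT.
rewrite (@big_cat_nat _ _ _ (c * L - m)) /=; [|exact: leq_sub2r|]; last first.
  by apply: leq_sub2r; rewrite leq_mul2r leqnSn orbT.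
rewrite big_nat_recr //= -IH //; congr (_ + _).
rewrite -{1}[(c * L - m)%N]add0n big_addn big_mkord.
have -> : (c.+1 * L - m - (c * L - m) = L)%N by rewrite mulSn; lia.
by apply: eq_bigr => r _; rewrite addnC.
Qed.

Section Scales.
Variable u0 : nat.

Definition block_scale k := (u0 ^ 2 ^ k)%N.
Local Notation scale := block_scale.

Definition block_length k := (scale k ^ 4)%N.
Local Notation len := block_length.

Hypothesis u2 : (2 <= u0)%N.

Lemma scaleS k : scale k.+1 = (scale k ^ 2)%N.
Proof. by rewrite /scale expnS mulnC expnM. Qed.

Lemma lenS k : len k.+1 = (len k * len k)%N.
Proof. by rewrite /len scaleS -expnM -expnD. Qed.

Lemma len1E k : len k.+1 = (scale k ^ 8)%N.
Proof. by rewrite /len scaleS -expnM. Qed.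

Lemma len3E k : len k.+3 = (scale k ^ 32)%N.
Proof. by rewrite /len !scaleS -!expnM. Qed.

Lemma scale_ge k : (u0 <= scale k)%N.
Proof.
by rewrite /scale -{1}(expn1 u0) leq_exp2l ?expn_gt0 ?u2.
Qed.

Lemma scale2 k : (2 <= scale k)%N.
Proof. exact: leq_trans u2 (scale_ge k). Qed.

Lemma scale_double k : (2 * scale k <= scale k.+1)%N.
Proof. by rewrite scaleS -mulnn leq_mul2r scale2 orbT. Qed.

Lemma scale_gt k : (k < scale k)%N.
Proof.
elim: k => [|k IH]; first exact: leq_trans (scale2 0).
by apply: leq_trans (scale_double k); rewrite mul2n -addnn; lia.
Qed.

Lemma len_gt0 k : (0 < len k)%N.
Proof. by rewrite expn_gt0 (leq_trans _ (scale2 k)). Qed.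

Lemma scale_le_len k : (scale k <= len k)%N.
Proof. by rewrite /len -{1}(expn1 (scale k)) leq_exp2l // scale2. Qed.

Lemma len_double k : (2 * len k <= len k.+1)%N.
Proof.
by rewrite lenS leq_mul2r (leq_trans (scale2 k) (scale_le_len k)) orbT.
Qed.

Lemma dvdn_len k K : (k <= K)%N -> (len k %| len K)%N.
Proof.
move=> /subnK <-; elim: (K - k)%N => [|d IH]; first exact: dvdnn.
by rewrite addSn lenS dvdn_mulr.
Qed.

Lemma len_le k K : (k <= K)%N -> (len k <= len K)%N.
Proof. by move=> h; apply: dvdn_leq (len_gt0 _) (dvdn_len h). Qed.

End Scales.

(** * Occurrence profiles of the blocks *)

Section Blocks.
Variables (R : realType) (A : finType).
Implicit Types (w X : seq A).
Variables (M : R) (z : bool -> nat -> R) (u0 : nat).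

Local Notation scale := (block_scale u0).
Local Notation len := (block_length u0).

Fixpoint block_family k : seq (seq A) :=
  if k is k'.+1 then step z (scale k') (block_family k')
  else [seq val t | t : (len 0).-tuple A].
Local Notation blocks := block_family.

Hypothesis M1 : 1 <= M.
Hypothesis zM : forall e n, `|z e n| <= M.
Hypothesis u2 : (2 <= u0)%N.
Hypothesis hu : forall v : nat, (u0 <= v)%N ->
  4 * v%:R ^+ 34 <= expR ((8 * M ^+ 2)^-1 * v%:R ^+ 2) :> R.
Hypothesis A0 : (0 < #|A|)%N.

Lemma scale_gt0R k : 0 < (scale k)%:R :> R.
Proof. by rewrite ltr0n (leq_trans _ (scale2 u2 k)). Qed.

Lemma blocks_gt0 k : (0 < size (blocks k))%N.
Proof.
elim: k => [|k IH] /=.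
  by rewrite size_map -cardE card_tuple expn_gt0 A0.
have v0 : (0 < scale k)%N by apply: leq_trans (scale2 u2 k).
have := size_step_ge (scale2 u2 k) (typical_frequent M1 zM v0 IH (hu (scale_ge u2 k))).
rewrite -(ltr_nat R); apply: lt_le_trans.
rewrite mulr_gt0 ?exprn_gt0 ?ltr0n // subr_gt0 invf_lt1 ?scale_gt0R // ltr1n.
exact: scale2.
Qed.

Lemma blocks_frequent k : #|[pred f | ~~ @typical R A z (scale k) (blocks k) f]|%:R *
  (scale k)%:R <= (size (blocks k))%:R ^+ (scale k ^ 4) :> R.
Proof.
apply: (typical_frequent M1 zM _ (blocks_gt0 k) (hu (scale_ge u2 k))).
exact: leq_trans (scale2 u2 k).
Qed.

Lemma size_block k : all (fun b => size b == len k) (blocks k).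
Proof.
elim: k => [|k IH] /=.
  by apply/allP => _ /mapP[t _ ->]; rewrite size_tuple.
apply/allP => _ /mapP[f _ ->]; rewrite /cat_blocks.
have h : all (fun b => size b == len k) [seq pick_block f i | i <- enum 'I_(scale k ^ 4)].
  by apply/allP => _ /mapP[i _ ->]; apply: (allP IH); exact: mem_tnth.
by rewrite (size_flatten_const h) size_map size_enum_ord lenS.
Qed.

Lemma size_mem_block k X : X \in blocks k -> size X = len k.
Proof. by move=> /(allP (size_block k)) /eqP. Qed.

Lemma pick_block_mem k q (f : {ffun 'I_q -> 'I_(size (blocks k))}) i :
  pick_block f i \in blocks k.
Proof. exact: mem_tnth. Qed.

Lemma all_pick_block k q (f : {ffun 'I_q -> 'I_(size (blocks k))}) :
  all (fun b => size b == len k) [seq pick_block f i | i <- enum 'I_q].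
Proof.
by apply/allP => _ /mapP[i _ ->]; apply: (allP (size_block k)); exact: mem_tnth.
Qed.

Lemma size_pick_blocks (B : seq (seq A)) q (f : {ffun 'I_q -> 'I_(size B)}) :
  size [seq pick_block f i | i <- enum 'I_q] = q.
Proof. by rewrite size_map size_enum_ord. Qed.

Lemma nth_pick_block k q (f : {ffun 'I_q -> 'I_(size (blocks k))}) (i : 'I_q) :
  nth [::] [seq pick_block f i | i <- enum 'I_q] i = pick_block f i.
Proof. by rewrite (nth_map i) ?size_enum_ord // nth_ord_enum. Qed.

(** The constituents can be read off a concatenation. Thus [size (blocks k)] counts words, as the
    entropy bound requires. *)
Lemma blocks_uniq k : uniq (blocks k).
Proof.
elim: k => [|k IH] /=.
  by rewrite map_inj_uniq ?enum_uniq //; exact: val_inj.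
rewrite map_inj_uniq; first by apply: filter_uniq; exact: enum_uniq.
move=> f g fg.
apply/ffunP => i.
have e (h : {ffun 'I_(scale k ^ 4) -> 'I_(size (blocks k))}) :
    pick_block h i = take (len k) (drop (i * len k) (cat_blocks h)).
  rewrite /cat_blocks (drop_flatten_const _ (all_pick_block h)).
  rewrite (drop_nth [::]) ?size_pick_blocks // nth_pick_block /=.
  by rewrite take_size_cat // (size_mem_block (pick_block_mem _ _)).
have : pick_block f i = pick_block g i by rewrite !e fg.
rewrite /pick_block !(tnth_nth [::]) /= => /eqP; rewrite nth_uniq //.
by move=> /eqP /val_inj.
Qed.

Lemma blocksS_cat k X : X \in blocks k.+1 ->
  exists2 f : {ffun 'I_(scale k ^ 4) -> 'I_(size (blocks k))},
    typical z f & X = cat_blocks f.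
Proof. by move=> /mapP[f]; rewrite mem_filter => /andP[h _] ->; exists f. Qed.

Lemma blocks_flatten k K X : (k <= K)%N -> X \in blocks K ->
  exists2 ws, all (mem (blocks k)) ws & X = flatten ws.
Proof.
move=> /subnK <-; elim: (K - k)%N X => [|d IH] X.
  by move=> h; exists [:: X]; rewrite /= ?h ?cats0.
rewrite addSn => /blocksS_cat[f _ ->].
have : all (mem (blocks (d + k))) [seq pick_block f i | i <- enum 'I_(scale (d + k) ^ 4)].
  by apply/allP => _ /mapP[i _ ->]; exact: pick_block_mem.
rewrite /cat_blocks; elim: [seq _ | _ <- _] => [|X' Xs IHs] /=; first by exists [::].
move=> /andP[/IH[ws1 h1 ->] /IHs[ws2 h2 ->]]; exists (ws1 ++ ws2).
  by rewrite all_cat h1 h2.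
by rewrite flatten_cat.
Qed.

Lemma all_size_blocks k ws : all (mem (blocks k)) ws -> all (fun b => size b == len k) ws.
Proof. by apply: sub_all => b /(allP (size_block k)). Qed.

Section Test.
Variables (l : nat) (w : seq A).
Let t := pickle (l, w).

Lemma test_pickle X p : test R t X p = (aligned_occurs l w X p)%:R.
Proof. by rewrite /test /t pickleK. Qed.

(** The mean occurrence profile of [w] along the blocks of level [k]; evaluated at [p %% len k], it
    becomes a periodic sequence. *)
Definition block_phase k p : R := avg (blocks k) (fun b => test R t b p).
Local Notation phase := block_phase.

Lemma phase_itv01 k p : 0 <= phase k p <= 1.
Proof. by apply: avg_itv01 => b; exact: test_itv01. Qed.

Lemma test_flatten k ws i r : (l %| len k)%N -> all (mem (blocks k)) ws ->
  (i < size ws)%N -> (r < len k)%N ->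
  test R t (flatten ws) (i * len k + r) = test R t (nth [::] ws i) r.
Proof.
move=> ld hws hi hr; rewrite !test_pickle (@aligned_occurs_flatten _ (len k)) //.
exact: all_size_blocks.
Qed.

Lemma test_cat_blocks k (f : {ffun 'I_(scale k ^ 4) -> 'I_(size (blocks k))})
    (i : 'I_(scale k ^ 4)) r : (l %| len k)%N -> (r < len k)%N ->
  test R t (cat_blocks f) (i * len k + r) = test R t (pick_block f i) r.
Proof.
move=> ld hr; rewrite /cat_blocks test_flatten ?size_pick_blocks ?nth_pick_block //.
by apply/allP => _ /mapP[j _ ->]; exact: pick_block_mem.
Qed.

Let phase_pos k p : (p < len k.+1)%N -> (p %/ len k < scale k ^ 4)%N.
Proof. by rewrite lenS => h; rewrite ltn_divLR ?(len_gt0 u2). Qed.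

Lemma phase_step k p : (l %| len k)%N -> (p < len k.+1)%N ->
  `|phase k.+1 p - phase k (p %% len k)| <= 2 / (scale k)%:R.
Proof.
move=> ld hp.
apply: (avg_step_close (scale2 u2 k) (blocks_gt0 k) (blocks_frequent k)
  (i0 := Ordinal (phase_pos hp))) => [b|f]; first exact: test_itv01.
rewrite {1}(divn_eq p (len k)) -(test_cat_blocks _ (Ordinal (phase_pos hp))) //.
by rewrite ltn_mod (len_gt0 u2).
Qed.

Lemma phase_step_le k p : (l %| len k)%N -> (p < len k.+1)%N ->
  phase k.+1 p <= (1 - (scale k)%:R^-1)^-1 * phase k (p %% len k).
Proof.
move=> ld hp.
apply: (avg_step_le (scale2 u2 k) (blocks_gt0 k) (blocks_frequent k)
  (i0 := Ordinal (phase_pos hp))) => [b|f]; first exact: test_itv01.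
rewrite {1}(divn_eq p (len k)) -(test_cat_blocks _ (Ordinal (phase_pos hp))) //.
by rewrite ltn_mod (len_gt0 u2).
Qed.

Lemma invr_scaleS k : ((scale k.+1)%:R^-1 <= (2 * (scale k)%:R)^-1 :> R).
Proof.
rewrite lef_pV2 ?posrE ?mulr_gt0 ?scale_gt0R // -natrM ler_nat; exact: scale_double u2 _.
Qed.

Lemma phase_close k K p : (l %| len k)%N -> (k <= K)%N ->
  `|phase K (p %% len K) - phase k (p %% len k)| <= 4 / (scale k)%:R.
Proof.
move=> ld kK.
(* The subtracted term makes the bound telescope: as [scale] at least doubles, 4 / u_j - 4 / u_(j+1)
   is at least 2 / u_j, the change allowed by [phase_step]. *)
suff : `|phase K (p %% len K) - phase k (p %% len k)| <=
    4 / (scale k)%:R - 4 / (scale K)%:R.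
  move=> h; apply: (le_trans h); rewrite gerDl oppr_le0 divr_ge0 //.
rewrite -(subnK kK); elim: (K - k)%N => [|d IH]; first by rewrite !subrr normr0.
rewrite addSn; set j := (d + k)%N in IH *.
have hj : (l %| len j)%N by rewrite (dvdn_trans ld) // dvdn_len // leq_addl.
have hp : (p %% len j.+1 < len j.+1)%N by rewrite ltn_mod (len_gt0 u2).
have := phase_step hj hp; rewrite modn_dvdm ?dvdn_len // => h1.
have := lerD h1 IH => h2.
have -> : phase j.+1 (p %% len j.+1) - phase k (p %% len k) =
  (phase j.+1 (p %% len j.+1) - phase j (p %% len j)) +
  (phase j (p %% len j) - phase k (p %% len k)) by ring.
apply: (le_trans (ler_normD _ _)); apply: (le_trans h2).
have := invr_scaleS j; rewrite invfM; lra.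
Qed.

End Test.
Local Notation phase := block_phase.

Section Deviation.
Variables (l : nat) (w : seq A) (e : bool).
Let t := pickle (l, w).

Lemma block_deviation k X j : (l %| len k)%N -> (t < scale k)%N -> X \in blocks k.+1 ->
  (j < len k.+3)%N ->
  `|\sum_(r < len k.+1) z e (j + r)%N * (test R t X r - phase l w k (r %% len k))|
    <= (scale k)%:R ^+ 7.
Proof.
move=> ld ht /blocksS_cat[f hf ->]; rewrite len3E => hj.
have := forallP hf (Ordinal ht) => /forallP /(_ (Ordinal hj)) /forallP /(_ e) /=.
congr (is_true (`|_| <= _)).
rewrite /dev -/(len k).
have := @sum_chunks _ (fun r => z e (j + r)%N * (test R t (cat_blocks f) r -
   phase l w k (r %% len k))) (len k) 0 0 (len k) isT isT.
rewrite !subn0 mul0n -lenS big_mkord => ->; rewrite big_mkord.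
apply: eq_bigr => i _; apply: eq_bigr => r _; rewrite subn0.
by rewrite test_cat_blocks // modnMDl modn_small.
Qed.

(** The blocks of level [k.+1] inside the factor are typical, and [n < len k.+3] keeps their offsets
    within the tested range; together they deviate by at most [n / scale k]. The two ends cost at
    most [2 * len k.+1 * M], where [len k.+1 <= n / scale k] because [n >= len k.+2]. *)
Lemma master_deviation k K X m n : (l %| len k)%N -> (t < scale k)%N ->
  X \in blocks K -> (k < K)%N -> (m + n <= size X)%N ->
  (len k.+2 <= n < len k.+3)%N ->
  `|\sum_(i < n) z e i * (test R t X (m + i) - phase l w k ((m + i) %% len k))|
    <= n%:R * ((2 * M + 1) / (scale k)%:R).
Proof.
move=> ld ht hX kK hmn /andP[n1 n2].
have [ws hws eX] := blocks_flatten kK hX.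
set L := len k.+1 in hws *.
have L0 : (0 < L)%N := len_gt0 u2 _.
have hL2 : (2 * L <= n)%N by apply: leq_trans n1; exact: len_double u2 _.
(* The complete blocks inside the factor are those numbered from [a], the ceiling of m / L, up to
   but excluding [c]. *)
pose a := ((m + L.-1) %/ L)%N; pose c := ((m + n) %/ L)%N.
have ma : (m <= a * L)%N.
  have := divn_eq (m + L.-1) L; rewrite -/a.
  have : ((m + L.-1) %% L < L)%N by rewrite ltn_mod.
  lia.
have am : (a * L <= m + L.-1)%N by rewrite leq_divM.
have cm : (c * L <= m + n)%N by rewrite leq_divM.
have mc : (m + n < c * L + L)%N.
  by have := ltn_ceil (m + n) L0; rewrite -/c mulSn [(L + _)%N]addnC.
have ac : (a <= c)%N.
  by rewrite -(leq_pmul2r L0); lia.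
pose D p := test R t X p - phase l w k (p %% len k).
have D1 p : `|D p| <= 1.
  have /andP[a1 a2] := test_itv01 R t X p.
  have /andP[a3 a4] := phase_itv01 l w k (p %% len k).
  by rewrite ler_norml /D; apply/andP; split; lra.
have M0 : 0 <= M by apply: le_trans M1.
have F1 i : `|z e i * D (m + i)%N| <= M by rewrite normrM -[leRHS]mulr1 ler_pM.
have sumM i1 i2 : `|\sum_(i1 <= i < i2) z e i * D (m + i)%N| <= (i2 - i1)%:R * M.
  apply: (le_trans (ler_norm_sum _ _ _)).
  apply: (@le_trans _ _ (\sum_(i1 <= i < i2) M)); first by apply: ler_sum.
  by rewrite sumr_const_nat mulr_natl.
have h7 : (scale k)%:R ^+ 7 = L%:R / (scale k)%:R :> R.
  by rewrite /L len1E natrX (exprSr _ 7) mulfK //; exact: (lt0r_neq0 (scale_gt0R k)).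
rewrite -/(D _) -(big_mkord xpredT (fun i => z e i * D (m + i)%N)).
rewrite (@big_cat_nat _ _ _ (a * L - m)) //=; last by lia.
rewrite (@big_cat_nat _ _ _ (c * L - m) (a * L - m)) /=; [|lia|lia].
have h1 := sumM 0%N (a * L - m)%N.
have h3 := sumM (c * L - m)%N n.
have h2 : `|\sum_(a * L - m <= i < c * L - m) z e i * D (m + i)%N| <=
   n%:R / (scale k)%:R.
  rewrite sum_chunks //.
  apply: (le_trans (ler_norm_sum _ _ _)).
  apply: (@le_trans _ _ (\sum_(a <= h < c) (L%:R / (scale k)%:R))); last first.
    rewrite sumr_const_nat -mulrnAl ler_pM2r ?invr_gt0 ?scale_gt0R //.
    rewrite -mulrnA ler_nat mulnBr ![(L * _)%N]mulnC; lia.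
  rewrite -h7; apply: ler_sum_nat => h /andP[ah hc].
  have hL : (m <= h * L)%N by apply: (leq_trans ma); rewrite leq_mul2r ah orbT.
  have hcL : (h.+1 * L <= m + n)%N by apply: leq_trans cm; rewrite leq_mul2r hc orbT.
  have hs : (h < size ws)%N.
    rewrite -(ltn_pmul2r L0) -(@size_flatten_const _ L); last exact: all_size_blocks.
    rewrite -eX; apply: leq_trans hmn; apply: leq_trans hcL.
    by rewrite mulSn; lia.
  have hC : nth [::] ws h \in blocks k.+1 by apply: (allP hws); exact: mem_nth.
  have hj : (h * L - m < len k.+3)%N.
    by apply: leq_trans n2; rewrite ltnS; move: hcL; rewrite mulSn; lia.
  apply: le_trans (block_deviation ld ht hC hj); apply: le_of_eq.
  congr `|_|; apply: eq_bigr => r _; congr (_ * _).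
  rewrite /D addnA subnKC // eX test_flatten ?(dvdn_trans ld) ?dvdn_len //.
  congr (_ - phase _ _ _ _); rewrite -modnDml.
  by have /eqP -> := dvdn_mull h (dvdn_len u0 (leqnSn k)).
apply: (le_trans (ler_normD _ _)); apply: (le_trans (lerD h1 (ler_normD _ _))).
apply: (le_trans (lerD (lexx _) (lerD h2 h3))).
have hb : (a * L - m - 0)%:R + (n - (c * L - m))%:R <= 2 * (L%:R : R).
  by rewrite -natrD -natrM ler_nat; lia.
have hLn : L%:R <= n%:R / (scale k)%:R :> R.
  rewrite ler_pdivlMr ?scale_gt0R // -natrM ler_nat.
  apply: leq_trans n1; rewrite lenS leq_mul2l; apply/orP; right.
  apply: leq_trans (scale_le_len u2 _) (len_le u2 _) => //.
have h4 := ler_wpM2r M0 hb; have h5 := ler_wpM2r M0 hLn.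
have -> : n%:R * ((2 * M + 1) / (scale k)%:R) =
  2 * (n%:R / (scale k)%:R * M) + n%:R / (scale k)%:R by ring.
rewrite mulrDl in h4; lra.
Qed.

End Deviation.
End Blocks.

(** * Sums of periodic sequences, alone and against an aperiodic one *)

Section Periodic.
Variable R : realType.

(** Nonnegativity makes the prefix sums monotone, so [n] may be enclosed between two consecutive
    multiples of the period. *)
Lemma periodic_prefix_sum (h : nat -> R) (l n : nat) : (0 < l)%N -> (forall r, 0 <= h r) ->
  `|\sum_(0 <= i < n) h (i %% l)%N - n%:R / l%:R * \sum_(r < l) h r| <= \sum_(r < l) h r.
Proof.
move=> l0 h0; set S := \sum_(r < l) h r.
have S0 : 0 <= S by apply: sumr_ge0.
have whole c : \sum_(0 <= i < c * l) h (i %% l)%N = c%:R * S.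
  have := @sum_chunks _ (fun i => h (i %% l)%N) l 0 0 c isT isT.
  rewrite !subn0 mul0n => ->.
  rewrite (eq_bigr (fun=> S)) ?sumr_const_nat ?subn0 ?mulr_natl // => c' _.
  by apply: eq_bigr => r _; rewrite subn0 modnMDl modn_small.
have mono a b : (a <= b)%N ->
    \sum_(0 <= i < a) h (i %% l)%N <= \sum_(0 <= i < b) h (i %% l)%N.
  move=> ab; rewrite (@big_cat_nat _ _ _ a 0 b) //= lerDl; exact: sumr_ge0.
have h1 := mono _ _ (leq_divM n l); rewrite whole in h1.
have h2 := mono _ _ (ltnW (ltn_ceil n l0)); rewrite whole -natr1 mulrDl mul1r in h2.
have lR : 0 < l%:R :> R by rewrite ltr0n.
have h3 : (n %/ l)%:R * S <= n%:R / l%:R * S.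
  by rewrite ler_wpM2r // ler_pdivlMr // -natrM ler_nat leq_divM.
have h4 : n%:R / l%:R * S <= ((n %/ l)%:R + 1) * S.
  by rewrite ler_wpM2r // ler_pdivrMr // natr1 -natrM ler_nat ltnW // ltn_ceil.
rewrite mulrDl mul1r in h4.
by rewrite ler_norml; apply/andP; split; lra.
Qed.

Lemma periodic_sum (h : nat -> R) (l m n : nat) : (0 < l)%N -> (forall r, 0 <= h r) ->
  `|\sum_(i < n) h ((m + i) %% l)%N - n%:R / l%:R * \sum_(r < l) h r|
    <= 2 * \sum_(r < l) h r.
Proof.
move=> l0 h0; have := periodic_prefix_sum (m + n) l0 h0; have := periodic_prefix_sum m l0 h0.
have -> : \sum_(0 <= i < m + n) h (i %% l)%N =
    \sum_(0 <= i < m) h (i %% l)%N + \sum_(i < n) h ((m + i) %% l)%N.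
  rewrite (@big_cat_nat _ _ _ m 0 (m + n)) ?leq_addr //=; congr (_ + _).
  rewrite -{1}[m]add0n big_addn addKn big_mkord.
  by apply: eq_bigr => i _; rewrite addnC.
rewrite natrD !mulrDl.
rewrite !ler_norml => /andP[a1 a2] /andP[b1 b2]; apply/andP; split; lra.
Qed.

(** The periodic factor is constant along each progression modulo [l], and there are only [l] of
    them. The threshold is uniform in [h] because [h] will be a profile shifted by the arbitrary
    starting point of a factor. *)
Lemma aperiodic_periodic_sum (y : nat -> R) (l : nat) (e : R) :
  aperiodic y ->
  (0 < l)%N -> 0 < e ->
  exists n0 : nat, forall n (h : nat -> R), (n0 <= n)%N -> (forall r, `|h r| <= 1) ->
    `|\sum_(i < n) y i.+1 * h (i %% l)%N| <= e * n%:R.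
Proof.
move=> [[M hM] hy] l0 e0.
have M0 : 0 <= M by apply: le_trans (hM 1%N isT).
have lR : 0 < l%:R :> R by rewrite ltr0n.
have progression r : exists c0, forall c, (c0 <= c)%N ->
    `|\sum_(1 <= i < c.+1) y (i * l + r.+1)%N| <= e / 2 * c%:R.
  have e2 : 0 < e / 2 by rewrite divr_gt0.
  have /cvgrPdist_lt /(_ _ e2) [c0 _ hc] := hy l r.+1 l0.
  exists c0.+1 => c cc; have := hc c (ltnW cc); rewrite sub0r normrN /= normrM.
  have c1 : 0 < c%:R :> R by rewrite ltr0n (leq_trans _ cc).
  rewrite normfV (gtr0_norm c1) mulrC ltr_pdivrMr // => /ltW; exact: id.
have [c0 hc0] : exists c0, forall r c, (r < l)%N -> (c0 <= c)%N ->
    `|\sum_(1 <= i < c.+1) y (i * l + r.+1)%N| <= e / 2 * c%:R.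
  suff H l' : exists c0, forall r c, (r < l')%N -> (c0 <= c)%N ->
      `|\sum_(1 <= i < c.+1) y (i * l + r.+1)%N| <= e / 2 * c%:R by exact: H.
  elim: l' => [|l' [c0 IH]]; first by exists 0%N.
  have [c1 h1] := progression l'; exists (maxn c0 c1) => r c; rewrite ltnS geq_max.
  move=> rl /andP[h2 h3]; move: rl; rewrite leq_eqVlt => /predU1P[->|rl]; first exact: h1.
  exact: IH.
(* An amount [l * M] is lost twice: to the terms with [i = 0], which the averages in [aperiodic]
   omit, and to the incomplete last period. This [n1] makes the loss at most [e * n / 2]. *)
pose n1 := Num.truncn (4 * l%:R * M / e).
exists (maxn (c0.+1 * l) n1.+1) => n h; rewrite geq_max => /andP[hn hn1] h1.
have c0n : (c0.+1 <= n %/ l)%N by rewrite leq_divRL.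
move: c0n; case ec : (n %/ l)%N => [//|c]; rewrite ltnS => c0c.
have clen : (c.+1 * l <= n)%N by rewrite -ec leq_divM.
rewrite -(big_mkord xpredT (fun i => y i.+1 * h (i %% l)%N)).
rewrite (@big_cat_nat _ _ _ (c.+1 * l)) //=.
have rest : `|\sum_(c.+1 * l <= i < n) y i.+1 * h (i %% l)%N| <= l%:R * M.
  apply: (le_trans (ler_norm_sum _ _ _)).
  apply: (@le_trans _ _ (\sum_(c.+1 * l <= i < n) M)).
    by apply: ler_sum => i _; rewrite normrM -[leRHS]mulr1 ler_pM // hM.
  rewrite sumr_const_nat -[leLHS]mulr_natl ler_wpM2r // ler_nat.
  by have := ltn_ceil n l0; rewrite ec; lia.
have main : `|\sum_(0 <= i < c.+1 * l) y i.+1 * h (i %% l)%N| <= l%:R * (M + e / 2 * c%:R).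
  have := @sum_chunks _ (fun i => y i.+1 * h (i %% l)%N) l 0 0 c.+1 isT isT.
  rewrite !subn0 mul0n => ->; rewrite exchange_big /=.
  apply: (le_trans (ler_norm_sum _ _ _)).
  rewrite mulr_natl -[X in _ *+ X](card_ord l) -sumr_const; apply: ler_sum => r _.
  have -> : \sum_(0 <= i < c.+1) y (i * l - 0 + r).+1 * h ((i * l - 0 + r) %% l)%N =
     h r * \sum_(0 <= i < c.+1) y (i * l + r.+1)%N.
    rewrite mulr_sumr; apply: eq_bigr => i _.
    by rewrite subn0 modnMDl modn_small // mulrC addnS.
  rewrite normrM -[leRHS]mul1r ler_pM // big_ltn // mul0n add0n.
  by apply: (le_trans (ler_normD _ _)); rewrite lerD // ?hM // hc0.
apply: (le_trans (ler_normD _ _)); apply: (le_trans (lerD main rest)).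
have f1 : 4 * l%:R * M <= e * n%:R.
  rewrite [e * _]mulrC -ler_pdivrMr //; apply: (le_trans (ltW (truncnS_gt _))).
  by rewrite ler_nat.
have f2 : l%:R * c%:R <= n%:R :> R.
  rewrite -natrM ler_nat; apply: leq_trans clen; rewrite mulnC leq_mul2r; lia.
have f3 := ler_wpM2l (ltW e0) f2.
nra.
Qed.

End Periodic.

(** * Comparison of long factors with a fixed periodic profile *)

Section Frequencies.
Variables (R : realType) (A : finType).
Implicit Types (w X : seq A).
Variables (M : R) (z : bool -> nat -> R) (u0 : nat).
Hypothesis M1 : 1 <= M.
Hypothesis zM : forall e n, `|z e n| <= M.
Hypothesis u2 : (2 <= u0)%N.
Hypothesis hu : forall v : nat, (u0 <= v)%N ->
  4 * v%:R ^+ 34 <= expR ((8 * M ^+ 2)^-1 * v%:R ^+ 2) :> R.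
Hypothesis A0 : (0 < #|A|)%N.

Local Notation len := (block_length u0).
Local Notation scale := (block_scale u0).
Local Notation blocks := (@block_family R A z u0).
Local Notation phase := (@block_phase R A z u0).

Lemma len_between k1 n : (len k1.+2 <= n)%N ->
  exists2 k, (k1 <= k)%N & (len k.+2 <= n < len k.+3)%N.
Proof.
move=> hn.
have ex : exists k, (n < len k.+3)%N.
  exists n; apply: (@leq_trans (len n)); last by apply: len_le => //; lia.
  by apply: leq_trans (scale_gt u2 n) (scale_le_len u2 n).
case: (ex_minnP ex) => k hk kmin.
have k1k : (k1 <= k)%N.
  rewrite leqNgt; apply/negP => kk1.
  have := len_le u2 (kk1 : (k.+3 <= k1.+2)%N); rewrite leqNgt => /negP; apply.
  exact: leq_ltn_trans hn hk.
exists k => //; rewrite hk andbT.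
move: k1k; rewrite leq_eqVlt => /predU1P[<- //|]; case: k hk kmin => // k hk kmin _.
by rewrite leqNgt; apply/negP => /kmin; rewrite ltnn.
Qed.

(** Counts the positions at which a word of length [s] would cross the end of its window: at most
    [s] per period, and the error term of [periodic_sum] turns 1 into 3. *)
Lemma straddle_sum l s m n : (0 < l)%N -> (s <= l)%N -> (l <= n)%N ->
  \sum_(i < n) (l < (m + i) %% l + s)%N%:R <= 3 * s%:R * (n%:R / l%:R) :> R.
Proof.
move=> l0 sl ln.
have := @periodic_sum R (fun r => (l < r + s)%N%:R) l m n l0 (fun r => ler0n _ _).
have hS : \sum_(r < l) (l < r + s)%N%:R <= s%:R :> R.
  rewrite -(big_mkord xpredT (fun r => (l < r + s)%N%:R)) /= -natr_sum ler_nat.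
  rewrite (@big_cat_nat _ _ _ (l - s)) ?leq_subr //= big_nat_cond big1 ?add0n; last first.
    by move=> r /andP[/andP[_ h] _]; lia.
  apply: (@leq_trans (\sum_(l - s <= i < l) 1)); first by apply: leq_sum => i _; exact: leq_b1.
  by rewrite sum_nat_const_nat muln1 subKn.
have S0 : 0 <= \sum_(r < l) (l < r + s)%N%:R :> R by apply: sumr_ge0.
set S := \sum_(r < l) _ in hS S0 *; rewrite ler_norml => /andP[_ h].
have d1 : 1 <= n%:R / l%:R :> R by rewrite ler_pdivlMr ?ltr0n // mul1r ler_nat.
set d := n%:R / l%:R in d1 h *.
have : S * d <= s%:R * d by apply: ler_wpM2r => //; lra.
have : s%:R <= s%:R * d by rewrite ler_peMr.
lra.
Qed.

(** Here [k] stays fixed while [n] grows. Three errors add up: the occurrences that cross windows of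
    length [len k], the deviation at the level [k'] imposed by [n], and the change of profile from
    [k'] back to [k]. *)
Lemma occurs_deviation w (eps : R) : 0 < eps ->
  exists k0, forall k, (k0 <= k)%N -> exists n0, forall e n K X m, (n0 <= n)%N ->
    X \in blocks K -> (m + n <= size X)%N ->
    `|\sum_(i < n) z e i * ((occurs w X (m + i))%:R - phase (len k) w k ((m + i) %% len k)%N)|
      <= eps * n%:R.
Proof.
move=> e0; set s := size w.
(* [2 * M + 1] comes from [master_deviation], [4 * M] from [phase_close] and [3 * M * s] from
   [straddle_sum]. *)
pose C := (6 * M + 1 + 3 * M * s%:R).
have M0 : 0 <= M by apply: le_trans M1.
have Ms0 : 0 <= M * s%:R by rewrite mulr_ge0.
have C0 : 0 <= C by rewrite /C; lra.
exists (maxn s (Num.truncn (C / eps))) => k; rewrite geq_max => /andP[ks k0].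
have kR := scale_gt0R R u2 k.
have hC : C / (scale k)%:R <= eps.
  rewrite ler_pdivrMr // mulrC -ler_pdivrMr //.
  apply: (le_trans (ltW (truncnS_gt _))); rewrite ler_nat.
  exact: leq_ltn_trans k0 (scale_gt u2 k).
pose t := pickle (len k, w).
exists (len (maxn k t).+2) => e n K X m hn hX hmn.
have [k' ] := len_between hn; rewrite geq_max => /andP[kk' tk'] hn'.
have kK : (k' < K)%N.
  rewrite ltnNge; apply/negP => Kk'; move: hmn.
  rewrite (size_mem_block hX) => h; have := leq_trans (leq_addl _ _) h.
  apply/negP; rewrite -ltnNge; case/andP: hn' => h' _; apply: leq_trans h'.
  apply: leq_ltn_trans (len_le u2 Kk') _.
  have := len_double u2 k'; have := len_double u2 k'.+1; have := len_gt0 u2 k'; lia.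
have ht : (t < scale k')%N by apply: leq_ltn_trans tk' (scale_gt u2 k').
have h1 := master_deviation M1 zM u2 A0 e (dvdn_len u0 kk') ht hX kK hmn hn'.
have h2 : `|\sum_(i < n) z e i * (phase (len k) w k' ((m + i) %% len k')%N -
    phase (len k) w k ((m + i) %% len k)%N)| <= n%:R * (M * (4 / (scale k)%:R)).
  apply: (le_trans (ler_norm_sum _ _ _)).
  rewrite mulr_natl -[X in _ *+ X](card_ord n) -sumr_const; apply: ler_sum => i _.
  by rewrite normrM ler_pM // (phase_close M1 zM u2 hu A0).
have kn : (len k <= n)%N.
  apply: leq_trans hn; apply: (len_le u2); exact: leq_trans (leq_maxl _ _) (ltnW (leqnSn _)).
have h3 : `|\sum_(i < n) z e i * ((occurs w X (m + i))%:R - test R t X (m + i))| <=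
    M * (3 * s%:R * (n%:R / (scale k)%:R)).
  have sl : (s <= len k)%N.
    by apply: leq_trans (scale_le_len u2 k); apply: leq_trans ks (ltnW (scale_gt u2 k)).
  apply: (le_trans (ler_norm_sum _ _ _)).
  apply: (@le_trans _ _ (M * \sum_(i < n) (len k < (m + i) %% len k + s)%N%:R)).
    rewrite mulr_sumr; apply: ler_sum => i _; rewrite normrM ler_pM //.
    rewrite /t test_pickle /aligned_occurs -/s ltnNge.
    by case: occurs; case: leq; rewrite /= ?subr0 ?subrr ?normr0 ?normr1.
  rewrite ler_wpM2l //; apply: (le_trans (straddle_sum m (len_gt0 u2 k) sl kn)).
  rewrite ler_wpM2l ?mulr_ge0 // ler_wpM2l // lef_pV2 ?posrE ?ltr0n ?(len_gt0 u2) //.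
    by rewrite ler_nat scale_le_len.
  exact: leq_trans (scale2 u2 k).
apply: (@le_trans _ _ `|\sum_(i < n) z e i * ((occurs w X (m + i))%:R - test R t X (m + i)) +
   (\sum_(i < n) z e i * (test R t X (m + i) - phase (len k) w k' ((m + i) %% len k')%N) +
    \sum_(i < n) z e i * (phase (len k) w k' ((m + i) %% len k')%N -
    phase (len k) w k ((m + i) %% len k)%N))|).
  apply: le_of_eq; congr `|_|.
  by rewrite -!big_split /=; apply: eq_bigr => i _; ring.
apply: (le_trans (ler_normD _ _)); apply: (le_trans (lerD h3 (ler_normD _ _))).
apply: (le_trans (lerD (lexx _) (lerD h1 h2))).
have h4 : (2 * M + 1) / (scale k')%:R <= (2 * M + 1) / (scale k)%:R.
  rewrite ler_wpM2l //; first lra.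
  rewrite lef_pV2 ?posrE ?(scale_gt0R R u2) // ler_nat /block_scale leq_exp2l //.
  by rewrite leq_exp2l.
apply: (@le_trans _ _ (C / (scale k)%:R * n%:R)); last by rewrite ler_wpM2r.
have := ler_wpM2l (ler0n R n) h4.
rewrite /C; set d := (scale k)%:R^-1; nra.
Qed.

End Frequencies.

(** * Frequencies of words *)

Local Open Scope classical_set_scope.
Local Open Scope ring_scope.

Lemma norm_le_eps (R : realFieldType) (x C : R) : 0 <= C ->
  (forall e, 0 < e -> `|x| <= C * e) -> x = 0.
Proof.
move=> C0 h; apply/eqP; rewrite -normr_le0; apply/ler_addgt0Pl => e e0.
rewrite addr0; have e1 : 0 < e / (C + 1) by rewrite divr_gt0 //; lra.
apply: (le_trans (h _ e1)); rewrite mulrCA ler_piMr //; first exact: ltW.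
by rewrite ler_pdivrMr ?mul1r; lra.
Qed.

Lemma norm_scale_sub (R : realDomainType) (c a b : R) : 0 < c ->
  c * `|a - b| = `|c * a - c * b|.
Proof. by move=> c0; rewrite -mulrBr normrM gtr0_norm. Qed.

Section Frequencies.
Variables (R : realType) (A : finType).
Implicit Types (w X : seq A).
Variables (M : R) (y : nat -> R) (u0 : nat).
(** The index is shifted because [y] starts at 1: sums over [i < n] then involve y_1, ..., y_n. *)
Definition weights (e : bool) (i : nat) : R := if e then y i.+1 else 1.
Hypothesis hy : aperiodic y.
Hypothesis M1 : 1 <= M.
Hypothesis zM : forall e n, `|weights e n| <= M.
Hypothesis u2 : (2 <= u0)%N.
Hypothesis hu : forall v : nat, (u0 <= v)%N ->
  4 * v%:R ^+ 34 <= expR ((8 * M ^+ 2)^-1 * v%:R ^+ 2) :> R.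
Hypothesis A0 : (0 < #|A|)%N.

Local Notation len := (block_length u0).
Local Notation scale := (block_scale u0).
Local Notation blocks := (@block_family R A weights u0).
Local Notation phase := (@block_phase R A weights u0).

Definition mean_phase k w : R := (\sum_(r < len k) phase (len k) w k r) / (len k)%:R.

Lemma phase_sum_le l w k n : \sum_(r < n) phase l w k r <= n%:R.
Proof.
rewrite -[X in _ <= X%:R](card_ord n) -sum1_card natr_sum; apply: ler_sum => r _.
by case/andP: (phase_itv01 weights u0 l w k r).
Qed.

Lemma phase_sum_ge0 l w k n : 0 <= \sum_(r < n) phase l w k r.
Proof. by apply: sumr_ge0 => r _; case/andP: (phase_itv01 weights u0 l w k r). Qed.

Lemma occurs_mean w (eps : R) : 0 < eps ->
  exists k0, forall k, (k0 <= k)%N -> exists n0, forall n K X m, (n0 <= n)%N ->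
    X \in blocks K -> (m + n <= size X)%N ->
    `|\sum_(i < n) (occurs w X (m + i))%:R - n%:R * mean_phase k w| <= eps * n%:R.
Proof.
move=> e0; have e2 : 0 < eps / 2 by rewrite divr_gt0.
have [k0 h0] := occurs_deviation M1 zM u2 hu A0 w e2; exists k0 => k /h0[n0 hn0].
exists (maxn n0 (Num.truncn (2 * (len k)%:R / (eps / 2))).+1) => n K X m.
rewrite geq_max => /andP[n0n hn] hX hmn.
have := hn0 false n K X m n0n hX hmn.
have := @periodic_sum R (phase (len k) w k) (len k) m n (len_gt0 u2 k)
  (fun r => proj1 (andP (phase_itv01 weights u0 (len k) w k r))).
have := phase_sum_le (len k) w k (len k).
have -> : n%:R / (len k)%:R * (\sum_(r < len k) phase (len k) w k r) = n%:R * mean_phase k w.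
  by rewrite /mean_phase; ring.
under [X in _ -> _ -> `|X| <= _ -> _]eq_bigr do rewrite /= mul1r.
rewrite sumrB.
have : 2 * (len k)%:R <= eps / 2 * n%:R.
  rewrite [leRHS]mulrC -ler_pdivrMr //; apply: (le_trans (ltW (truncnS_gt _))).
  by rewrite ler_nat.
rewrite !ler_norml => a1 a2 /andP[a3 a4] /andP[a5 a6]; apply/andP; split; lra.
Qed.

(** Both means approximate the frequency of [w] in one and the same long block. *)
Lemma mean_phase_cauchy w (eps : R) : 0 < eps ->
  exists k0, forall k k', (k0 <= k)%N -> (k0 <= k')%N ->
    `|mean_phase k w - mean_phase k' w| <= eps.
Proof.
move=> e0; have e2 : 0 < eps / 2 by rewrite divr_gt0.
have [k0 h0] := occurs_mean w e2; exists k0 => k k' /h0[n1 h1] /h0[n2 h2].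
pose K := maxn n1 n2.
have K0 := blocks_gt0 M1 zM u2 hu A0 K.
pose X := nth [::] (blocks K) 0.
have hX : X \in blocks K by exact: mem_nth.
have sX := size_mem_block hX.
have KX : (K <= size X)%N.
  by rewrite sX; apply: leq_trans (ltnW (scale_gt u2 K)) (scale_le_len u2 K).
have := h1 (size X) K X 0%N (leq_trans (leq_maxl _ _) KX) hX (leqnn _).
have := h2 (size X) K X 0%N (leq_trans (leq_maxr _ _) KX) hX (leqnn _).
have n0 : 0 < (size X)%:R :> R by rewrite ltr0n sX len_gt0.
move=> h2' h1'.
rewrite -(ler_pM2l n0) (norm_scale_sub _ _ n0).
move: h1' h2'; rewrite !ler_norml.
by move=> /andP[a3 a4] /andP[a5 a6]; apply/andP; split; lra.
Qed.

Definition block_freq w : R := lim (mean_phase k w @[k --> \oo]).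
Local Notation freq := block_freq.

Lemma freq_cvg w : mean_phase k w @[k --> \oo] --> freq w.
Proof.
apply: cauchy_cvg; apply: cauchy_exP => e e0.
have [k0 h] := mean_phase_cauchy w (divr_gt0 e0 (ltr0n R 2)).
exists (mean_phase k0 w); exists k0 => // k /= hk.
rewrite /ball /=; apply: (le_lt_trans (h _ _ (leqnn _) hk)).
by rewrite ltr_pdivrMr //; lra.
Qed.

Lemma occurs_freq w (eps : R) : 0 < eps ->
  exists n0, forall n K X m, (n0 <= n)%N ->
    X \in blocks K -> (m + n <= size X)%N ->
    `|\sum_(i < n) (occurs w X (m + i))%:R - n%:R * freq w| <= eps * n%:R.
Proof.
move=> e0; have e2 : 0 < eps / 2 by rewrite divr_gt0.
have [k0 h0] := occurs_mean w e2.
have /cvgrPdist_le /(_ _ e2) [k1 _ h1] := @freq_cvg w.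
have [n0 hn0] := h0 (maxn k0 k1) (leq_maxl _ _).
have := h1 (maxn k0 k1) (leq_maxr _ _) => /=.
set a := mean_phase _ _ in hn0 * => ha.
exists n0 => n K X m hn hX hmn; have := hn0 n K X m hn hX hmn.
move: ha; have n1 : 0 <= n%:R :> R by [].
rewrite !ler_norml => /andP[a3 a4] /andP[a5 a6].
have b3 := ler_wpM2l n1 a3; have b4 := ler_wpM2l n1 a4.
by apply/andP; split; lra.
Qed.

Lemma occurs_uncorrelated w (eps : R) : 0 < eps ->
  exists n0, forall n K X m, (n0 <= n)%N ->
    X \in blocks K -> (m + n <= size X)%N ->
    `|\sum_(i < n) y i.+1 * (occurs w X (m + i))%:R| <= eps * n%:R.
Proof.
move=> e0; have e2 : 0 < eps / 2 by rewrite divr_gt0.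
have [k h0] := occurs_deviation M1 zM u2 hu A0 w e2.
have [n0 hn0] := h0 k (leqnn _).
have [n1 hn1] := aperiodic_periodic_sum hy (len_gt0 u2 k) e2.
exists (maxn n0 n1) => n K X m; rewrite geq_max => /andP[n0n n1n] hX hmn.
have := hn0 true n K X m n0n hX hmn.
have := hn1 n (fun r => phase (len k) w k ((m + r) %% len k)%N) n1n.
have h r : `|phase (len k) w k ((m + r) %% len k)%N| <= 1.
  have /andP[a b] := phase_itv01 weights u0 (len k) w k ((m + r) %% len k)%N.
  by rewrite ler_norml b (le_trans _ a) // oppr_le0.
move=> /(_ h).
under [X in `|X| <= _ -> _]eq_bigr do rewrite modnDmr.
under [X in _ -> `|X| <= _ -> _]eq_bigr do rewrite /= mulrBr.
rewrite sumrB => a1 a2; have := lerD a1 a2.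
by move/(le_trans (ler_normD _ _)); rewrite addrC subrK -mulrDl -splitr.
Qed.

Lemma long_block n : exists K X, X \in blocks K /\ (n <= size X)%N.
Proof.
have K0 := blocks_gt0 M1 zM u2 hu A0 n.
have hX : nth [::] (blocks n) 0 \in blocks n by exact: mem_nth.
exists n, (nth [::] (blocks n) 0); split=> //.
rewrite (size_mem_block hX).
by apply: leq_trans (ltnW (scale_gt u2 n)) (scale_le_len u2 n).
Qed.

Lemma freq_ge0 w : 0 <= freq w.
Proof.
apply: (limr_ge (@freq_cvg w)); apply: nearW => k.
by rewrite /mean_phase divr_ge0 // phase_sum_ge0.
Qed.

Lemma freq_nil : freq [::] = 1.
Proof.
apply/eqP; rewrite -subr_eq0; apply/eqP; apply: (@norm_le_eps R _ 1) => // e e0.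
have [n0 h] := occurs_freq [::] e0.
have [K [X [hX hn]]] := long_block n0.+1.
have := h n0.+1 K X 0%N (leqnSn _) hX hn.
under [X in `|X - _| <= _ -> _]eq_bigr do rewrite /occurs /= take0 eqxx.
rewrite sumr_const card_ord => h'; have c0 : 0 < n0.+1%:R :> R by [].
by rewrite mul1r -(ler_pM2l c0) (norm_scale_sub _ _ c0) mulr1 distrC [_ * e]mulrC.
Qed.

Lemma occurs_rcons w X p : (p + size w < size X)%N ->
  \sum_a (occurs (rcons w a) X p)%:R = (occurs w X p)%:R :> R.
Proof.
move=> h; have hs : (size w < size (drop p X))%N by rewrite size_drop; lia.
have /card_gt0P[a0 _] := A0.
have e a : occurs (rcons w a) X p = occurs w X p && (a == nth a0 (drop p X) (size w)).
  rewrite /occurs size_rcons (take_nth a0) // eqseq_rcons; congr (_ && _); exact: eq_sym.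
under eq_bigr do rewrite e.
rewrite (bigD1 (nth a0 (drop p X) (size w))) //= eqxx andbT big1 ?addr0 // => a /negbTE ->.
by rewrite andbF.
Qed.

Lemma occurs_cons w X p : (p < size X)%N ->
  \sum_a (occurs (a :: w) X p)%:R = (occurs w X p.+1)%:R :> R.
Proof.
move=> h; have /card_gt0P[a0 _] := A0.
have e a : occurs (a :: w) X p = (a == nth a0 X p) && occurs w X p.+1.
  by rewrite /occurs (drop_nth a0) //= eqseq_cons eq_sym.
under eq_bigr do rewrite e.
by rewrite (bigD1 (nth a0 X p)) //= eqxx big1 ?addr0 // => a /negbTE ->.
Qed.

Lemma uniform_threshold (eps : R) (I : finType) (F : I -> seq A) : 0 < eps ->
  exists n0, forall i n K X m, (n0 <= n)%N ->
    X \in blocks K -> (m + n <= size X)%N ->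
    `|\sum_(j < n) (occurs (F i) X (m + j))%:R - n%:R * freq (F i)| <= eps * n%:R.
Proof.
move=> e0; have /choice[t ht] i := occurs_freq (F i) e0.
by exists (\max_i t i)%N => i n K X m hn; apply: ht; apply: leq_trans hn; exact: leq_bigmax.
Qed.

(** An identity between counts passes to the limit. It serves for the extension of [w] on the right
    ([d = 0]) and on the left ([d = 1]), where occurrences of [w] start one position later. *)
Lemma freq_sum w (F : A -> seq A) (d : nat) :
  (forall X p, (p + (size w).+1 < size X)%N ->
     \sum_a (occurs (F a) X p)%:R = (occurs w X (p + d))%:R :> R) -> (d <= 1)%N ->
  \sum_a freq (F a) = freq w.
Proof.
move=> hF d1; apply/eqP; rewrite -subr_eq0; apply/eqP.
apply: (@norm_le_eps R _ (#|A|%:R + 1)); first by rewrite addr_ge0.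
move=> e e0.
have [n1 h1] := uniform_threshold F e0.
have [n2 h2] := occurs_freq w e0.
pose n := (maxn n1 n2).+1.
have [K [X [hX hn]]] := long_block (n + (size w).+2).
have hnX : (0 + n <= size X)%N by apply: leq_trans hn; lia.
have hndX : (d + n <= size X)%N by apply: leq_trans hn; lia.
have g1 a := h1 a n K X 0%N (leq_trans (leq_maxl _ _) (leqnSn _)) hX hnX.
have g2 := h2 n K X d (leq_trans (leq_maxr _ _) (leqnSn _)) hX hndX.
have n0 : 0 < n%:R :> R by [].
have e1 : \sum_a \sum_(j < n) (occurs (F a) X (0 + j))%:R =
    \sum_(j < n) (occurs w X (d + j))%:R :> R.
  rewrite exchange_big /=; apply: eq_bigr => j _; rewrite add0n addnC hF //.
  by apply: leq_trans hn; have := ltn_ord j; lia.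
have g3 : `|\sum_(j < n) (occurs w X (d + j))%:R - n%:R * \sum_a freq (F a)| <=
    #|A|%:R * (e * n%:R).
  rewrite -e1 mulr_sumr -sumrB; apply: (le_trans (ler_norm_sum _ _ _)).
  by rewrite mulr_natl -sumr_const; apply: ler_sum.
rewrite -(ler_pM2l n0) (norm_scale_sub _ _ n0).
move: g2 g3; rewrite !ler_norml => /andP[a1 a2] /andP[a3 a4].
by apply/andP; split; lra.
Qed.

Lemma freq_rcons w : \sum_a freq (rcons w a) = freq w.
Proof.
by apply: (@freq_sum w _ 0) => // X p h; rewrite addn0 occurs_rcons //; lia.
Qed.

Lemma freq_cons w : \sum_a freq (a :: w) = freq w.
Proof.
by apply: (@freq_sum w _ 1) => // X p h; rewrite addn1 occurs_cons //; lia.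
Qed.

Lemma freq_gt0_occurs w : 0 < freq w ->
  exists K X m, [/\ X \in blocks K, occurs w X m & (m < size X)%N].
Proof.
move=> fw; have e2 : 0 < freq w / 2 by rewrite divr_gt0.
have [n0 h] := occurs_freq w e2.
have [K [X [hX hn]]] := long_block n0.+1.
have := h (size X) K X 0%N (ltnW hn) hX (leqnn _).
have [/existsP[i hi] _|/existsPn no] := boolP [exists i : 'I_(size X), occurs w X i].
  by exists K, X, i; split.
rewrite big1 => [|i _]; last by rewrite add0n (negbTE (no i)).
have X0 : 0 < (size X)%:R :> R by rewrite ltr0n (leq_trans _ hn).
rewrite sub0r normrN mulrC normrM (gtr0_norm fw) (gtr0_norm X0) ler_pM2r //; lra.
Qed.

End Frequencies.

Lemma sumr_const_seq (V : nmodType) (I : Type) (s : seq I) (c : V) :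
  \sum_(x <- s) c = c *+ size s.
Proof. by rewrite big_const_seq count_predT iter_addr_0. Qed.

(** * The number of words of positive frequency *)

Section Counting.
Variables (R : realType) (A : finType).
Implicit Types (w X : seq A).
Variables (M : R) (y : nat -> R) (u0 : nat).
Hypothesis hy : aperiodic y.
Hypothesis M1 : 1 <= M.
Hypothesis zM : forall e n, `|weights y e n| <= M.
Hypothesis u4 : (4 <= u0)%N.
Hypothesis hu : forall v : nat, (u0 <= v)%N ->
  4 * v%:R ^+ 34 <= expR ((8 * M ^+ 2)^-1 * v%:R ^+ 2) :> R.
Hypothesis A0 : (0 < #|A|)%N.

Local Notation len := (block_length u0).
Local Notation scale := (block_scale u0).
Local Notation blocks := (@block_family R A (weights y) u0).
Local Notation phase := (@block_phase R A (weights y) u0).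
Local Notation freq := (@block_freq R A y u0).

Let u2 : (2 <= u0)%N. Proof. exact: leq_trans u4. Qed.

Let scale_inv_le k : 2 / (scale k)%:R <= 2^-1 :> R.
Proof.
rewrite ler_pdivrMr ?scale_gt0R // mulrC ler_pdivlMr // -natrM ler_nat.
exact: leq_trans u4 (scale_ge u2 k).
Qed.

Lemma ln_size_blocks k :
  (len k)%:R * (ln #|A|%:R - 2 / u0%:R) <= ln (size (blocks k))%:R :> R.
Proof.
(* The extra [2 / scale k] pays for keeping only half of the concatenations at each level: it drops
   by at least [1 / scale k], while the factor 2 costs [ln 2 <= 1] for [len k.+1] letters. *)
suff h : (len k)%:R * (ln #|A|%:R - 2 / u0%:R + 2 / (scale k)%:R) <=
    ln (size (blocks k))%:R :> R.
  apply: le_trans h; rewrite ler_wpM2l // lerDl divr_ge0 //.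
elim: k => [|k IH].
  rewrite /block_scale expn0 expn1 subrK /= size_map -cardE card_tuple natrX lnXn ?ltr0n //.
  by rewrite mulr_natl.
have v0 := scale_gt0R R u2 k; have v1 := scale_gt0R R u2 k.+1.
have b0 : 0 < (size (blocks k))%:R :> R by rewrite ltr0n (blocks_gt0 M1 zM u2 hu A0).
have := size_step_ge (scale2 u2 k) (blocks_frequent M1 zM u2 hu A0 k).
set b := (size (blocks k))%:R in IH b0 *; rewrite -/(blocks k.+1) => h.
have hb : 2^-1 * b ^+ (len k) <= (size (blocks k.+1))%:R.
  apply: le_trans h; rewrite ler_wpM2r //; first by rewrite exprn_ge0 // ltW.
  by have := scale_inv_le k; lra.
have q0 : 0 < b ^+ (len k) by rewrite exprn_gt0.
have {hb} : ln (2^-1 * b ^+ (len k)) <= ln (size (blocks k.+1))%:R.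
  rewrite ler_ln ?posrE // ?mulr_gt0 // ltr0n.
  exact: (blocks_gt0 M1 zM u2 hu A0 k.+1).
apply: le_trans; rewrite lnM ?posrE // lnV ?posrE // lnXn // -[_ *+ len k]mulr_natl.
have l2 : ln 2 <= 1 :> R.
  by rewrite (_ : 2 = 1 + 1) //; apply: le_ln1Dx; lra.
have hI := ler_wpM2l (ler0n R (len k)) IH.
apply: (@le_trans _ _
  ((len k)%:R * ((len k)%:R * (ln #|A|%:R - 2 / u0%:R + 2 / (scale k)%:R)) - 1));
  last first.
  by lra.
have i1 := invr_scaleS R u2 k; rewrite invfM in i1.
have i2 : 1 <= (len k)%:R * ((len k)%:R * (scale k)%:R^-1) :> R.
  rewrite mulr_ege1 ?ler1n ?(len_gt0 u2) // ler_pdivlMr // mul1r ler_nat.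
  exact: scale_le_len.
rewrite lenS natrM.
have i3 := ler_wpM2l (mulr_ge0 (ler0n R (len k)) (ler0n R (len k))) i1.
set L := (len k)%:R in i2 i3 *; set d := (scale k)%:R^-1 in i1 i2 i3 *.
set d' := (scale k.+1)%:R^-1 in i1 i3 *; set g := ln _ - _.
nra.
Qed.

Lemma phase_aligned_le k K w p : (k <= K)%N -> w \in blocks k -> (p < len K)%N ->
  (p %% len k = 0)%N -> phase (len k) w K p <= 2 / (size (blocks k))%:R.
Proof.
move=> kK hw; have b0 : 0 < (size (blocks k))%:R :> R.
  by rewrite ltr0n (blocks_gt0 M1 zM u2 hu A0).
(* At level [k] the value is at most 1 / b_k, as the blocks are distinct, and each level j
   multiplies it by at most 1 / (1 - 1 / u_j). The correction in parentheses bounds the accumulated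
   loss, and it is at most 1/2 because [u0 >= 4]. *)
suff h p' : (p' < len K)%N -> (p' %% len k = 0)%N ->
    phase (len k) w K p' * (1 - (2 / (scale k)%:R - 2 / (scale K)%:R)) <=
      1 / (size (blocks k))%:R.
  move=> hp p0; have := h p hp p0.
  have /andP[f0 _] := phase_itv01 (weights y) u0 (len k) w K p.
  have := scale_inv_le k; have : 0 <= (scale K)%:R^-1 :> R by [].
  set f := phase _ _ _ _ in f0 *; set i := (scale k)%:R^-1; set j := (scale K)%:R^-1.
  set b := (size _)%:R^-1; nra.
rewrite -(subnK kK); elim: (K - k)%N p' => [|d IH] p'.
  rewrite add0n => hp p0; rewrite subrr subr0 mulr1.
  move: p0; rewrite modn_small // => ->.
  rewrite /block_phase /avg ler_wpM2r ?invr_ge0 //.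
  have ub := blocks_uniq A (weights y) u0 k.
  rewrite (bigD1_seq w) //= [X in _ + X]big_seq_cond big1 ?addr0.
    by have /andP[] := test_itv01 R (pickle (len k, w)) w 0.
  move=> b /andP[hb bw]; rewrite test_pickle /aligned_occurs /occurs drop0.
  by rewrite (size_mem_block hw) take_oversize ?(size_mem_block hb) // (negbTE bw).
rewrite addSn; set j := (d + k)%N in IH * => hp p0.
have kj : (k <= j)%N by exact: leq_addl.
have hj : (len k %| len j)%N by exact: dvdn_len.
have h1 := phase_step_le M1 zM u2 hu A0 w hj hp.
have h2 := IH (p' %% len j)%N (ltn_pmod _ (len_gt0 u2 j)).
rewrite modn_dvdm // in h2; have {}h2 := h2 p0.
apply: le_trans h2.
have /andP[f0 _] := phase_itv01 (weights y) u0 (len k) w j (p' %% len j).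
have /andP[g0 _] := phase_itv01 (weights y) u0 (len k) w j.+1 p'.
have i1 := invr_scaleS R u2 j; rewrite invfM in i1.
have s1 := scale_inv_le k; have s2 := scale_inv_le j.
have i0 : 0 <= (scale j)%:R^-1 :> R by [].
have i0' : 0 <= (scale j.+1)%:R^-1 :> R by [].
have i3 : (scale j)%:R^-1 <= (scale k)%:R^-1 :> R.
  by rewrite lef_pV2 ?posrE ?(scale_gt0R R u2) // ler_nat /block_scale leq_exp2l // leq_exp2l.
set f := phase _ _ _ _ in f0 h1 *; set g := phase _ _ _ _ in g0 h1 *.
move: h1; rewrite mulrC ler_pdivlMr; last by lra.
set a := (scale k)%:R^-1 in s1 i3 *; set e := (scale j)%:R^-1 in i0 i1 i3 s2 *.
set e' := (scale j.+1)%:R^-1 in i0' i1 * => h1.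
apply: (@le_trans _ _ (g * (1 - e) * (1 - (2 * a - 2 * e)))); last first.
  by rewrite ler_wpM2r //; lra.
rewrite -mulrA ler_wpM2l //; nra.
Qed.

(** Double counting of the occurrences [T w] of [k]-blocks at aligned positions of the [K]-blocks.
    Their total is at least the number Z of these positions; any [w] gets at most 2 Z / b, and for
    large [K] a [w] of frequency 0 gets at most Z / (2 b). Hence 1 <= 2 c / b + 1/2. *)
Lemma positive_blocks k :
  (size (blocks k) <= 4 * count (fun w => (0 < freq w)%R) (blocks k))%N.
Proof.
set b := size (blocks k); set c := count _ _.
have b0 : (0 < b)%N by rewrite (blocks_gt0 M1 zM u2 hu A0).
have bR : 0 < b%:R :> R by rewrite ltr0n.
have lR : 0 < (len k)%:R :> R by rewrite ltr0n len_gt0.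
(* With [len K = H * len k], this makes [eps * len K] equal to [H / (2 * b)]. *)
pose eps : R := (2 * b%:R * (len k)%:R)^-1.
have e0 : 0 < eps by rewrite invr_gt0 !mulr_gt0.
have [n0 hn0] := uniform_threshold M1 zM u2 hu A0 (fun i : 'I_b => nth [::] (blocks k) i) e0.
pose K := maxn n0 k; have kK : (k <= K)%N by exact: leq_maxr.
have lenK : (n0 <= len K)%N.
  apply: leq_trans (scale_le_len u2 K); apply: leq_trans (ltnW (scale_gt u2 K)).
  exact: leq_maxl.
have [H eH] : exists H, len K = (H * len k)%N by have /dvdnP := dvdn_len u0 kK.
have H0 : (0 < H)%N by have := len_gt0 u2 K; rewrite eH; case: (H).
have HR : 0 < H%:R :> R by rewrite ltr0n.
have bK0 : 0 < (size (blocks K))%:R :> R by rewrite ltr0n (blocks_gt0 M1 zM u2 hu A0).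
pose T w : R := \sum_(X <- blocks K) \sum_(h < H) test R (pickle (len k, w)) X (h * len k).
have T_total : (size (blocks K))%:R * H%:R <= \sum_(w <- blocks k) T w.
  rewrite exchange_big /= mulr_natl -sumr_const_seq big_seq [leRHS]big_seq.
  apply: ler_sum => X hX; rewrite exchange_big /=.
  have -> : H%:R = \sum_(h < H) 1 :> R by rewrite sumr_const card_ord.
  apply: ler_sum => h _.
  have [ws hws eX] := blocks_flatten kK hX.
  have sw : size ws = H.
    apply/eqP; rewrite -(eqn_pmul2r (len_gt0 u2 k)) -eH -(size_mem_block hX) eX.
    by rewrite (@size_flatten_const _ (len k)) //; exact: all_size_blocks hws.
  have hmem : nth [::] ws h \in blocks k.
    by apply: (allP hws); rewrite mem_nth // sw.
  rewrite (bigD1_seq _ hmem (blocks_uniq A (weights y) u0 k)) /=.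
  apply: ler_wpDr; first apply: sumr_ge0 => w _.
    by case/andP: (test_itv01 R (pickle (len k, w)) X (h * len k)).
  rewrite -[(h * len k)%N]addn0 eX (@test_flatten R A (weights y)) ?dvdnn ?sw ?(len_gt0 u2) //.
  rewrite test_pickle /aligned_occurs /occurs drop0 take_size eqxx mod0n add0n.
  by rewrite (size_mem_block hmem) leqnn.
have T_pos w : w \in blocks k -> T w <= (size (blocks K))%:R * H%:R * (2 / b%:R).
  move=> hw; rewrite /T exchange_big /=.
  have -> : (size (blocks K))%:R * H%:R * (2 / b%:R) =
      \sum_(h < H) (size (blocks K))%:R * (2 / b%:R) :> R.
    by rewrite sumr_const card_ord -[RHS]mulr_natl; ring.
  apply: ler_sum => h _; rewrite mulrC -ler_pdivrMr //.
  apply: (@phase_aligned_le k K w (h * len k) kK hw); last exact: modnMl.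
  by rewrite eH ltn_pmul2r ?(len_gt0 u2).
have T_null w : w \in blocks k -> ~~ (0 < freq w) ->
    T w <= (size (blocks K))%:R * H%:R / (2 * b%:R).
  move=> hw; rewrite lt0r negb_and negbK (freq_ge0 M1 zM u2 hu A0) orbF => /eqP f0.
  have -> : (size (blocks K))%:R * H%:R / (2 * b%:R) = (size (blocks K))%:R * (eps * (len K)%:R).
    by rewrite eH natrM /eps; field; rewrite !gt_eqF.
  rewrite mulr_natl -sumr_const_seq /T big_seq [leRHS]big_seq; apply: ler_sum => X hX.
  have hi : (index w (blocks k) < b)%N by rewrite index_mem.
  have := hn0 (Ordinal hi) (len K) K X 0%N lenK hX.
  rewrite add0n (size_mem_block hX) /= nth_index // f0 mulr0 subr0 => /(_ (leqnn _)).
  apply: le_trans; apply: le_trans (ler_norm _).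
  rewrite -(big_mkord xpredT (fun i => (occurs w X (0 + i))%:R)).
  have := @sum_chunks _ (fun i => (occurs w X (0 + i))%:R : R) (len k) 0 0 H isT isT.
  rewrite !subn0 mul0n -eH => ->; rewrite big_mkord; apply: ler_sum => h _.
  rewrite -(big_mkord xpredT (fun r => (occurs w X (0 + (h * len k - 0 + r)))%:R)).
  rewrite big_ltn ?(len_gt0 u2) // add0n subn0 addn0; apply: ler_wpDr; first exact: sumr_ge0.
  by rewrite test_pickle ler_nat /aligned_occurs; case: occurs => //; exact: leq_b1.
have T_le : \sum_(w <- blocks k) T w <=
    c%:R * ((size (blocks K))%:R * H%:R * (2 / b%:R)) +
    b%:R * ((size (blocks K))%:R * H%:R / (2 * b%:R)).
  rewrite (bigID (fun w => 0 < freq w)) /=; apply: lerD.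
    rewrite /c -sum1_count natr_sum mulr_suml big_seq_cond [leRHS]big_seq_cond.
    by apply: ler_sum => w /andP[hw _]; rewrite mul1r; exact: T_pos.
  rewrite [leRHS]mulr_natl -sumr_const_seq big_seq_cond [leRHS]big_seq.
  rewrite big_mkcondr /=; apply: ler_sum => w hw.
  case: ifPn => [hf|_]; first exact: T_null.
  by rewrite divr_ge0 // mulr_ge0.
have := le_trans T_total T_le.
set Z := (size (blocks K))%:R * H%:R; have Z0 : 0 < Z by rewrite mulr_gt0.
have -> : c%:R * (Z * (2 / b%:R)) + b%:R * (Z / (2 * b%:R)) = Z * (2 * c%:R / b%:R + 2^-1).
  by field; rewrite gt_eqF.
rewrite -{1}[Z]mulr1 ler_pM2l // -lerBlDr ler_pdivlMr // => h.
rewrite -(ler_nat R) natrM; lra.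
Qed.

Lemma positive_words_card k :
  (count (fun w => (0 < freq w)%R) (blocks k)
    <= #|[pred t : (len k).-tuple A | (0 < freq t)%R]|)%N.
Proof.
rewrite -size_filter cardE -(size_map val).
apply: uniq_leq_size; first by rewrite filter_uniq // blocks_uniq.
move=> w; rewrite mem_filter => /andP[fw hw]; apply/mapP.
have sw : size w == len k by rewrite (size_mem_block hw).
by exists (Tuple sw); rewrite ?mem_enum.
Qed.

Lemma positive_words_growth (eps : R) : 0 < eps -> 2 / u0%:R <= eps / 2 ->
  forall n0, exists2 n, (n0 <= n)%N &
   n%:R * (ln #|A|%:R - eps) <= ln #|[pred t : n.-tuple A | 0 < freq t]|%:R :> R.
Proof.
move=> e0 ue n0; pose k := maxn n0 (Num.truncn (8 / eps)).
have lk : (k < len k)%N by apply: leq_trans (scale_gt u2 k) (scale_le_len u2 k).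
exists (len k); first by apply: leq_trans (ltnW lk); exact: leq_maxl.
have h8 : 4 <= (len k)%:R * (eps / 2).
  rewrite mulrA ler_pdivlMr // -ler_pdivrMr // -natrM.
  apply: (le_trans (ltW (truncnS_gt _))); rewrite ler_nat; apply: leq_trans lk.
  by rewrite ltnS leq_maxr.
have b0 : 0 < (size (blocks k))%:R :> R by rewrite ltr0n (blocks_gt0 M1 zM u2 hu A0).
set p := #|[pred t : (len k).-tuple A | (0 < freq t)%R]|.
have hp : (size (blocks k))%:R <= 4 * p%:R :> R.
  rewrite -natrM ler_nat (leq_trans (positive_blocks k)) // leq_mul2l /=.
  exact: positive_words_card.
have p0 : 0 < p%:R :> R by lra.
have : ln (size (blocks k))%:R <= ln (4 * p%:R) :> R by rewrite ler_ln ?posrE ?mulr_gt0.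
rewrite lnM ?posrE // => h1; have h2 := ln_size_blocks k.
have l4 : ln 4 <= 4 :> R.
  have -> : 4 = 1 + 3 :> R by ring.
  by apply: (le_trans (le_ln1Dx _)); lra.
have := ler_wpM2l (ler0n R (len k)) ue.
set L := (len k)%:R in h2 h8 *; nra.
Qed.

End Counting.

Definition factor (A : Type) (x : nat -> A) (m n : nat) : seq A :=
  [seq x i | i <- iota m n].

Lemma size_factor (A : Type) (x : nat -> A) m n : size (factor x m n) = n.
Proof. by rewrite size_map size_iota. Qed.

Lemma take_drop_factor (A : Type) (x : nat -> A) m n i s : (i + s <= n)%N ->
  take s (drop i (factor x m n)) = factor x (m + i) s.
Proof.
move=> h; rewrite /factor -map_drop -map_take drop_iota take_iota.
by have -> : minn s (n - i) = s by lia.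
Qed.

Lemma take_factor (A : Type) (x : nat -> A) m n s : (s <= n)%N ->
  take s (factor x m n) = factor x m s.
Proof. by move=> h; rewrite -{1}[factor x m n]drop0 take_drop_factor ?addn0. Qed.

(** All that is retained of the blocks: [fr] is a consistent, shift-invariant weight on words, and
    its positive words are numerous. The estimates now concern infinite sequences with positive
    factors, uniformly. *)
Lemma symbolic_core (R : realType) (A : finType) (y : nat -> R) (eps : R) :
  aperiodic y -> (0 < #|A|)%N -> 0 < eps ->
  exists fr : seq A -> R,
  [/\ fr [::] = 1, (forall w, 0 <= fr w),
      (forall w, \sum_a fr (rcons w a) = fr w) & (forall w, \sum_a fr (a :: w) = fr w)] /\
  [/\ (forall w (e : R), 0 < e -> exists n0, forall n (x : nat -> A), (n0 <= n)%N ->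
         (forall m k, 0 < fr (factor x m k)) ->
         `|\sum_(i < n) (factor x i (size w) == w)%:R - n%:R * fr w| <= e * n%:R),
      (forall w (e : R), 0 < e -> exists n0, forall n (x : nat -> A), (n0 <= n)%N ->
         (forall m k, 0 < fr (factor x m k)) ->
         `|\sum_(i < n) y i.+1 * (factor x i (size w) == w)%:R| <= e * n%:R) &
      (forall n0, exists2 n, (n0 <= n)%N &
         n%:R * (ln #|A|%:R - eps) <= ln #|[pred t : n.-tuple A | 0 < fr t]|%:R :> R)].
Proof.
move=> hy A0 e0; have [[M0 hM0] _] := hy.
pose M := Num.max 1 M0.
have M1 : 1 <= M by rewrite /M le_max lexx.
have zM e n : `|weights y e n| <= M.
  case: e => /=; last by rewrite normr1.
  by apply: (le_trans (hM0 _ (ltn0Sn n))); rewrite /M le_max lexx orbT.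
have c0 : 0 < (8 * M ^+ 2)^-1.
  by rewrite invr_gt0 mulr_gt0 // exprn_gt0 // (lt_le_trans ltr01).
have [U hU] := expR_sq_ge_pow c0.
(* 4 serves for the bound on aligned blocks, [U] for Chernoff's bound, and the last term for the
   entropy. *)
pose u0 := maxn (maxn 4 U) (Num.truncn (4 / eps)).+1.
have u4 : (4 <= u0)%N by rewrite !leq_max leqnn.
have u2 : (2 <= u0)%N by exact: leq_trans u4.
have hu v : (u0 <= v)%N -> 4 * v%:R ^+ 34 <= expR ((8 * M ^+ 2)^-1 * v%:R ^+ 2) :> R.
  by rewrite !geq_max => /andP[/andP[_ h] _]; exact: hU.
have ue : 2 / u0%:R <= eps / 2.
  have h : 4 / eps <= u0%:R.
    by apply: (le_trans (ltW (truncnS_gt _))); rewrite ler_nat leq_maxr.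
  rewrite ler_pdivrMr in h => //.
  by rewrite ler_pdivrMr ?ltr0n ?(leq_trans _ u4) //; lra.
pose fr := @block_freq R A y u0; exists fr; split.
  split; [exact: (freq_nil M1 zM u2 hu A0)|exact: (freq_ge0 M1 zM u2 hu A0)|
          exact: (freq_rcons M1 zM u2 hu A0)|exact: (freq_cons M1 zM u2 hu A0)].
(* Every prefix of [x], having positive frequency, occurs in some block, so the estimates for
   factors of blocks apply to [x]. *)
have inside (x : nat -> A) (N : nat) : (forall m k, 0 < fr (factor x m k)) ->
    exists K (X : seq A) m, X \in @block_family R A (weights y) u0 K /\
    take N (drop m X) = factor x 0 N.
  move=> /(_ 0%N N) /(freq_gt0_occurs M1 zM u2 hu A0)[K [X [m [hX + _]]]].
  by rewrite /occurs size_factor => /eqP h; exists K, X, m.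
have transfer (x : nat -> A) w n : (forall m k, 0 < fr (factor x m k)) ->
    exists K (X : seq A) m, [/\ X \in @block_family R A (weights y) u0 K, (m + n <= size X)%N &
      forall i, (i < n)%N -> occurs w X (m + i) = (factor x i (size w) == w)].
  move=> hx; have [K [X [m [hX e]]]] := inside x (n + (size w).+1)%N hx.
  have hs : (m + (n + (size w).+1) <= size X)%N.
    have := size_factor x 0 (n + (size w).+1); rewrite -e size_take size_drop.
    by case: ltnP; lia.
  exists K, X, m; split=> //; first by lia.
  move=> i hi; have := @take_drop_factor _ x 0 (n + (size w).+1) i (size w).
  rewrite add0n -e /occurs => <-; last by lia.
  have -> : (n + (size w).+1 = n + (size w).+1 - i + i)%N by lia.
  by rewrite -take_drop take_takel ?drop_drop 1?addnC //; lia.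
split.
- move=> w e h; have [n0 hn0] := occurs_freq M1 zM u2 hu A0 w h.
  exists n0 => n x hn /(transfer x w n)[K [X [m [hX hm ho]]]].
  have := hn0 n K X m hn hX hm; congr (is_true (`|_ - _| <= _)).
  by apply: eq_bigr => i _; rewrite ho.
- move=> w e h; have [n0 hn0] := occurs_uncorrelated hy M1 zM u2 hu A0 w h.
  exists n0 => n x hn /(transfer x w n)[K [X [m [hX hm ho]]]].
  have := hn0 n K X m hn hX hm; congr (is_true (`|_| <= _)).
  by apply: eq_bigr => i _; rewrite ho.
- exact: (positive_words_growth M1 zM u4 hu A0 e0 ue).
Qed.

(** * Topology of a subshift *)

Section FullShift.
Variable L : finType.
Implicit Types (x : full_shift L).

Lemma factor_eqP (x x' : nat -> L) m n :
  factor x m n = factor x' m n <-> forall i, (i < n)%N -> x (m + i)%N = x' (m + i)%N.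
Proof.
split=> [h i hi|h].
  have e (z : nat -> L) : nth (x m) (factor z m n) i = z (m + i)%N.
    by rewrite (nth_map m) ?size_iota // nth_iota.
  by rewrite -!e h.
by apply/eq_in_map => i; rewrite mem_iota => /andP[a b]; rewrite -(subnKC a) h //; lia.
Qed.

Lemma nbhs_coord x t : nbhs x [set x' : full_shift L | x' t = x t].
Proof.
have /(pointwise_cvgP (U := nat) (V := discrete_topology L) (F := nbhs x)) /(_ t) :
  {ptws, nbhs x --> (x : nat -> discrete_topology L)} by exact: cvg_id.
by move=> /(_ _ (discrete_set1 (x t : discrete_topology L))).
Qed.

Lemma nbhs_prefix x n : nbhs x [set x' : full_shift L | factor x' 0 n = factor x 0 n].
Proof.
elim: n => [|n IH]; first exact: filterE.
apply: filterS (filterI IH (nbhs_coord x n)) => x' /= [h1 h2].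
apply/factor_eqP => i; rewrite ltnS leq_eqVlt => /predU1P[-> //|hi].
by move/factor_eqP: h1; exact.
Qed.

(** The sets that contain a cylinder around [x] form a filter. It converges to [x] in each
    coordinate, hence in the product topology, so every neighbourhood belongs to it. *)
Lemma nbhs_full_shiftP x (U : set (full_shift L)) : nbhs x U ->
  exists n, [set x' : full_shift L | factor x' 0 n = factor x 0 n] `<=` U.
Proof.
pose F : set_system (nat -> discrete_topology L) := fun V =>
  exists n, [set x' : nat -> discrete_topology L | factor x' 0 n = factor x 0 n] `<=` V.
have FF : Filter F.
  split=> [|P Q [n hn] [m hm]|P Q PQ [n hn]].
  - by exists 0%N.
  - exists (maxn n m) => x' /= h; split; [apply: hn|apply: hm] => /=.
      by rewrite -(@take_factor _ x' 0 (maxn n m)) ?leq_maxl // h take_factor ?leq_maxl.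
    by rewrite -(@take_factor _ x' 0 (maxn n m)) ?leq_maxr // h take_factor ?leq_maxr.
  - by exists n; exact: subset_trans PQ.
have Fx : {ptws, F --> (x : nat -> discrete_topology L)}.
  apply/pointwise_cvgP => t; apply/discrete_cvg.
  exists t.+1 => x' /= h.
  by move/factor_eqP: h => /(_ t (ltnSn t)).
by move=> /Fx.
Qed.

Lemma full_shift_compact : compact [set: full_shift L].
Proof.
have cL : compact [set: discrete_topology L].
  by apply: finite_compact; exact: (@finite_finset L setT).
have := @tychonoff _ (fun _ : nat => discrete_topology L) _ (fun=> cL).
by congr (compact _); rewrite eqEsubset.
Qed.

End FullShift.

Section Subshift.
Variables (L : finType) (S : subshift L).
Local Notation X := (subshift_space S).

Definition prefix_word (n : nat) (x : X) : seq L := factor (\val x) 0 n.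

Lemma size_prefix_word n x : size (prefix_word n x) = n.
Proof. exact: size_factor. Qed.

Lemma take_prefix_word s n x : (s <= n)%N -> take s (prefix_word n x) = prefix_word s x.
Proof. exact: take_factor. Qed.

Lemma prefix_word_le s n x x' : (s <= n)%N -> prefix_word n x = prefix_word n x' ->
  prefix_word s x = prefix_word s x'.
Proof. by move=> h e; rewrite -(take_prefix_word x h) e take_prefix_word. Qed.

Lemma val_subshift_continuous : continuous (\val : X -> full_shift L).
Proof. exact: initial_continuous. Qed.

Lemma nbhs_prefix_word (x : X) n : nbhs x [set x' | prefix_word n x' = prefix_word n x].
Proof. exact: (val_subshift_continuous (nbhs_prefix (\val x) n)). Qed.

Lemma nbhs_subshiftP (x : X) (U : set X) : nbhs x U ->
  exists n, [set x' | prefix_word n x' = prefix_word n x] `<=` U.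
Proof.
rewrite nbhsE => -[W [oW Ox] OU].
have [V oV VO] : exists2 V : set (full_shift L), open V & \val @^-1` V = W by exact: oW.
have /nbhs_full_shiftP[n hn] : nbhs (\val x) V.
  by apply: open_nbhs_nbhs; split=> //; move: Ox; rewrite -VO.
by exists n => x' hx'; apply: OU; rewrite -VO; apply: hn.
Qed.

Lemma prefix_word_open n (P : set (seq L)) : open [set x | P (prefix_word n x)].
Proof.
rewrite openE => x /= Px; apply: filterS (nbhs_prefix_word x n) => x' /= ->.
exact: Px.
Qed.

(* A cluster point of points witnessing the failure at every length n would
   lie in some member of the cover, together with a whole cylinder. *)
Lemma lebesgue_number (U : set (set X)) : open_cover U ->
  exists n, forall x, exists2 W, U W & [set x' | prefix_word n x' = prefix_word n x] `<=` W.
Proof.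
move=> [Uo UT]; apply: contrapT => /forallNP no.
have /choice[bad hbad] n : exists x, forall W, U W ->
    ~ ([set x' | prefix_word n x' = prefix_word n x] `<=` W).
  have /existsNP[x hx] := no n; exists x => W UW sub; apply: hx; exists W => //.
have cS : compact (S : set (full_shift L)).
  apply: subclosed_compact (@full_shift_compact L) _ => //; exact: subshift_closed.
have [|z [Sz cz]] := cS (fmap (fun n => \val (bad n)) \oo) _.
  by exists 0%N => // n _ /=; exact: set_valP.
pose zX : X := exist _ z (mem_set Sz).
have [W UW Oz] : exists2 W, U W & W zX.
  by have : [set: X] zX by []; rewrite -UT => -[W UW Wz]; exists W.
have [n hn] := nbhs_subshiftP (open_nbhs_nbhs (conj (Uo _ UW) Oz)).
(* The points [bad m] with [m >= n] form a set of the filter, so one of them shares its first [n]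
   letters with [z]. *)
have [_ [[m nm <-] hm]] := cz _ _ (ex_intro2 _ _ n I (fun m h => ex_intro2 _ _ m h erefl)
  : (fmap (fun n => \val (bad n)) \oo) [set \val (bad m) | m in [set m | (n <= m)%N]])
  (nbhs_prefix z n).
apply: (hbad m W UW) => x' /= hx'; apply: hn => /=.
by rewrite (prefix_word_le nm hx').
Qed.

Lemma subshift_uniform_continuity (R : realType) (f : X -> R) (e : R) :
  continuous f -> 0 < e ->
  exists n, forall x x', prefix_word n x = prefix_word n x' -> `|f x - f x'| <= e.
Proof.
move=> cf e0; have e2 : 0 < e / 2 by rewrite divr_gt0.
pose U := [set W : set X | open W /\ forall x x', W x -> W x' -> `|f x - f x'| <= e].
have [|n hn] := @lebesgue_number U.
  split=> [W [] //|]; rewrite -subTset => x _.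
  exists (f @^-1` ball (f x) (e / 2)); last exact: ballxx.
  split.
    by apply: open_comp; [move=> *; exact: cf|exact: ball_open].
  move=> x1 x2; rewrite /preimage /ball /= => h1 h2.
  have := ltrD h1 h2; rewrite -splitr => /ltW; apply: le_trans.
  by rewrite [`|f x - f x1|]distrC; apply: le_trans (ler_normD _ _); rewrite addrA subrK.
exists n => x x' e'; have [W [_ hO] sub] := hn x'.
by apply: hO; apply: sub.
Qed.

End Subshift.

(** * The invariant measure *)

Section Coding.
Variables (R : realType) (L : finType) (fr : seq L -> R).
Hypothesis fr_nil : fr [::] = 1.
Hypothesis fr_ge0 : forall w, 0 <= fr w.
Hypothesis fr_rcons : forall w, \sum_a fr (rcons w a) = fr w.
Hypothesis fr_cons : forall w, \sum_a fr (a :: w) = fr w.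

Definition supported (x : nat -> L) : Prop := forall m k, 0 < fr (factor x m k).

(* Left endpoints of the intervals coding the words, for reversed words:
   the interval of [w] is cut into consecutive intervals of lengths
   [fr (rcons w a)]. *)
Fixpoint rev_left (v : seq L) : R :=
  if v is a :: v' then
    rev_left v' + \sum_(b | (enum_rank b < enum_rank a)%N) fr (rcons (rev v') b)
  else 0.

Definition left_end (w : seq L) : R := rev_left (rev w).

Definition coded_itv (w : seq L) (t : R) : bool := left_end w <= t < left_end w + fr w.
Local Notation coded := coded_itv.

Lemma left_end_rcons w a : left_end (rcons w a) =
  left_end w + \sum_(b | (enum_rank b < enum_rank a)%N) fr (rcons w b).
Proof. by rewrite /left_end rev_rcons /= revK. Qed.

Lemma coded_rcons w a t : coded (rcons w a) t -> coded w t.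
Proof.
rewrite /coded left_end_rcons => /andP[h1 h2]; apply/andP; split.
  by apply: le_trans h1; rewrite lerDl sumr_ge0.
apply: (lt_le_trans h2); rewrite -addrA lerD2l -(fr_rcons w) [leRHS](bigD1 a) //= addrC lerD2l.
rewrite big_mkcond [leRHS]big_mkcond /=; apply: ler_sum => b _.
case: ifP => [h|_]; last by case: ifP.
by case: eqP => // e; rewrite e ltnn in h.
Qed.

Lemma coded_rcons_inj w a b t : coded (rcons w a) t -> coded (rcons w b) t -> a = b.
Proof.
wlog ab : a b / (enum_rank a <= enum_rank b)%N => [hw|].
  case: (leqP (enum_rank a) (enum_rank b)) => h ha hb; first exact: hw.
  by apply/esym; apply: hw (ltnW h) hb ha.
move: ab; rewrite leq_eqVlt => /orP[/eqP /val_inj /enum_rank_inj //|ab].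
rewrite /coded !left_end_rcons => /andP[_ h1] /andP[h2 _].
have := le_lt_trans h2 h1; rewrite -addrA ltrD2l ltNge => /negP; case.
rewrite addrC [leRHS](bigD1 a) //= lerD2l.
rewrite big_mkcond [leRHS]big_mkcond /=; apply: ler_sum => c _.
case: ifP => [h|_]; last by case: ifP.
rewrite (ltn_trans h ab) /=; case: eqP => // e; by rewrite e ltnn in h.
Qed.

Lemma coded_inj w w' t : size w = size w' -> coded w t -> coded w' t -> w = w'.
Proof.
elim/last_ind: w w' => [|w a IH] w'; first by move=> /esym /size0nil ->.
case/lastP: w' => [|w' b]; first by rewrite size_rcons.
rewrite !size_rcons => -[hs] h1 h2.
have e := IH _ hs (coded_rcons h1) (coded_rcons h2).
by rewrite -e in h2 *; rewrite (coded_rcons_inj h1 h2).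
Qed.

Lemma coded_extend w t : coded w t -> exists a, coded (rcons w a) t.
Proof.
move=> /andP[h1 h2].
(* The partial sums of the subdivision of the interval of [w]; the wanted letter has the rank [i] at
   which they pass [t - left_end w]. *)
pose P i := \sum_(b : L | (enum_rank b < i)%N) fr (rcons w b).
have ex : exists i, t - left_end w < P i.
  exists #|L|; rewrite /P (eq_bigl xpredT) => [|b]; last by rewrite ltn_ord.
  by rewrite fr_rcons ltrBlDl.
case: (ex_minnP ex) => -[|i] hi hmin.
  by move: hi; rewrite /P big_pred0 // => hi; lra.
have Pi : P i <= t - left_end w.
  by rewrite leNgt; apply/negP => /hmin; rewrite ltnn.
have iL : (i < #|L|)%N.
  rewrite ltnNge; apply/negP => Li.
  have : P i.+1 <= P i.
    rewrite /P big_mkcond [leRHS]big_mkcond /=; apply: ler_sum => b _.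
    by rewrite (leq_trans (ltn_ord (enum_rank b)) Li) (leq_trans (ltn_ord (enum_rank b)) (leqW Li)).
  by move: hi Pi; lra.
exists (enum_val (Ordinal iL)); rewrite /coded left_end_rcons enum_valK /=.
apply/andP; split; first by rewrite -lerBrDl.
rewrite -addrA -ltrBlDl; apply: (lt_le_trans hi).
rewrite /P (bigD1 (enum_val (Ordinal iL))) ?enum_valK //= addrC lerD2r.
rewrite big_mkcond [leRHS]big_mkcond /=; apply: ler_sum => b _.
case: (altP eqP) => [->|nb]; first by rewrite andbF; case: ifP.
rewrite andbT ltnS leq_eqVlt; case: eqP => //= e.
by case/eqP: nb; apply: enum_rank_inj; apply: val_inj; rewrite enum_valK /=.
Qed.

Lemma fr_cat_le u v : fr (u ++ v) <= fr v.
Proof.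
elim: u => [//|a u IH] /=; apply: le_trans IH.
by rewrite -[leRHS]fr_cons (bigD1 a) //= lerDl sumr_ge0.
Qed.

Lemma coded_gt0 w t : coded w t -> 0 < fr w.
Proof. by move=> /andP[h1 h2]; move: (le_lt_trans h1 h2); rewrite ltrDl. Qed.

(** A factor is a suffix of a prefix, and by [fr_cons] suffixes are at least as frequent. *)
Lemma supported_prefix x : (forall n, 0 < fr (factor x 0 n)) -> supported x.
Proof.
move=> h m k; apply: lt_le_trans (h (m + k)%N) _.
have -> : factor x 0 (m + k) = factor x 0 m ++ factor x m k.
  by rewrite /factor iotaD map_cat.
exact: fr_cat_le.
Qed.

(** The interval of each prefix contains [t], hence has positive length: no [t] has to be excluded,
    and the coded sequence always lies in the subshift. *)
Lemma coding_exists t : 0 <= t < 1 ->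
  exists x : nat -> L, supported x /\ forall w, coded w t = (factor x 0 (size w) == w).
Proof.
move=> ht; have c0 : coded [::] t by rewrite /coded /left_end /= fr_nil add0r.
pose W := {w : seq L | coded w t}.
have next (w : W) : {a : L | coded (rcons (sval w) a) t}.
  by apply: cid; apply: coded_extend; case: w.
pose step (w : W) : W := exist _ (rcons (sval w) (sval (next w))) (svalP (next w)).
pose path n : W := iter n step (exist _ [::] c0).
pose x n : L := sval (next (path n)).
have xE n : factor x 0 n = sval (path n).
  elim: n => [//|n IH]; rewrite /factor -addn1 iotaD map_cat -/(factor x 0 n) IH.
  by rewrite addn1 /= add0n cats1.
have xc n : coded (factor x 0 n) t by rewrite xE; exact: (svalP (path n)).
exists x; split; first by apply: supported_prefix => n; exact: coded_gt0 (xc n).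
move=> w; apply/idP/eqP => [h|<- //].
by apply: coded_inj (xc _) h; rewrite size_factor.
Qed.

Lemma coded_bounds w t : coded w t -> 0 <= t < 1.
Proof.
elim/last_ind: w => [|w a IH]; last by move/coded_rcons.
by rewrite /coded /left_end /= fr_nil add0r.
Qed.

Lemma exists_subshift : exists S : subshift L, forall x, subshift_set S x <-> supported x.
Proof.
(* The sequence coding 0 shows that the subshift is nonempty. *)
have [x [sx _]] : exists x : nat -> L,
    supported x /\ forall w, coded w 0 = (factor x 0 (size w) == w).
  by apply: coding_exists; rewrite lexx ltr01.
have cl : closed [set x : full_shift L | supported x].
  move=> z cz m k; have [z' [/= sz' e]] := cz _ (nbhs_prefix z (m + k)).
  have := sz' m k; congr (is_true (0 < fr _)).
  by apply/factor_eqP => i hi; move/factor_eqP: e; apply; rewrite ltn_add2l.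
have inv : @shift_map L @` [set x : full_shift L | supported x] `<=` [set x | supported x].
  move=> _ [z sz <-] m k; have := sz m.+1 k; congr (is_true (0 < fr _)).
  by rewrite /factor -[m.+1]add1n iotaDl -map_comp.
by exists (Subshift (ex_intro _ x sx : [set x : full_shift L | supported x] !=set0) cl inv).
Qed.

End Coding.

(** * Cylinders generate the Borel sets *)

Section Borel.
Variables (R : realType) (L : finType) (S : subshift L).
Local Notation X := (subshift_space S).
Local Notation borel := (g_sigma_algebraType (@open X)).

Definition cylinder (w : seq L) : set X := [set x | prefix_word (size w) x = w].
Local Notation cyl := cylinder.

Lemma cyl_open w : open (cyl w).
Proof. exact: (@prefix_word_open L S (size w) (fun v => v = w)). Qed.

Lemma cyl_measurable w : measurable (cyl w : set borel).
Proof. by apply: sub_sigma_algebra; exact: cyl_open. Qed.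

Definition cyls_below (U : set X) (n : nat) : set X :=
  if unpickle n is Some w then (if `[< cyl w `<=` U >] then cyl w else set0) else set0.

Lemma open_bigcup_cyl U : open U -> U = \bigcup_n cyls_below U n.
Proof.
move=> oU; rewrite eqEsubset; split=> x.
  move=> Ux; have [n hn] := nbhs_subshiftP (open_nbhs_nbhs (conj oU Ux)).
  exists (pickle (prefix_word n x)) => //; rewrite /cyls_below pickleK.
  have h : cyl (prefix_word n x) `<=` U.
    by move=> x' hx'; apply: hn; rewrite /= -[RHS]hx' size_prefix_word.
  by case: asboolP => // _; rewrite /cyl /= size_prefix_word.
by case=> n _; rewrite /cyls_below; case: unpickle => [w|//]; case: asboolP => // + /[dup]; move/[apply].
Qed.

(** The empty set is included for closure under intersection: incompatible words have disjoint
    cylinders. *)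
Definition cylinders : set (set X) := [set A | A = set0 \/ exists w, A = cyl w].

Lemma cylinders_setI : setI_closed cylinders.
Proof.
move=> A B [->|[v ->]]; first by rewrite set0I; left.
move=> [->|[w ->]]; first by rewrite setI0; left.
wlog vw : v w / (size v <= size w)%N => [hw|].
  by case: (leqP (size v) (size w)) => [|/ltnW]; [|rewrite setIC]; exact: hw.
have [e|ne] := eqVneq (take (size v) w) v.
  right; exists w; rewrite eqEsubset; split=> [x []//|x xw]; split=> //.
  by rewrite /cyl /= -(take_prefix_word x vw) xw.
left; rewrite -subset0 => x [xv xw]; move/eqP: ne; apply.
by rewrite -[w in take _ w]xw take_prefix_word.
Qed.

Lemma borel_cylinders : @measurable _ borel = <<s cylinders >>.
Proof.
rewrite eqEsubset; split; apply: smallest_sub; try exact: smallest_sigma_algebra.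
  move=> U /open_bigcup_cyl ->.
  pose GT : measurableType _ := g_sigma_algebraType cylinders.
  apply: (@bigcupT_measurable _ GT) => n; apply: sub_sigma_algebra.
  rewrite /cyls_below; case: unpickle => [w|]; last by left.
  by case: asboolP => _; [right; exists w|left].
by move=> A [->|[w ->]]; [exact: measurable0|exact: cyl_measurable].
Qed.

Lemma borel_probability_unique (m1 m2 : probability borel R) :
  (forall w, m1 (cyl w) = m2 (cyl w)) -> forall A, measurable A -> m1 A = m2 A.
Proof.
move=> h A mA.
apply: (@measure_unique _ R borel cylinders (fun=> setT)
  borel_cylinders cylinders_setI).
- move=> _; right; exists [::]; rewrite eqEsubset; split=> // x _.
- by rewrite bigcup_const.
- by move=> B [->|[w ->]]; [rewrite !measure0|exact: h].
- by move=> _ /=; rewrite probability_setT ltry.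
- exact: mA.
Qed.

Local Notation T := (@subshift_map L S).

Lemma prefix_word_iter n k x : prefix_word n (iter k T x) = factor (\val x) k n.
Proof.
elim: k n x => [//|k IH] n x; rewrite iterSr IH.
by rewrite /factor -[k.+1]add1n iotaDl -map_comp.
Qed.

Lemma preimage_iter_open k U : open U -> open (iter k T @^-1` U).
Proof.
move=> oU; rewrite openE => x /= Ux.
have [n hn] := nbhs_subshiftP (open_nbhs_nbhs (conj oU Ux)).
apply: filterS (nbhs_prefix_word x (k + n)) => x' /= h; apply: hn => /=.
rewrite !prefix_word_iter; apply/factor_eqP => i hi.
by move/factor_eqP: h; apply; rewrite ltn_add2l.
Qed.

Lemma shift_measurable : measurable_fun setT (T : borel -> borel).
Proof.
apply: (@measurability _ _ borel borel setT T (@open X) erefl).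
move=> _ [U oU <-]; rewrite setTI; apply: sub_sigma_algebra.
exact: (preimage_iter_open 1).
Qed.

Lemma invariant_of_cyl (mu : probability borel R) :
  (forall w, mu (T @^-1` cyl w) = mu (cyl w)) -> invariant_probability (T : X -> X) mu.
Proof.
move=> h A mA; pose Tm : {mfun borel >-> borel} :=
  HB.pack (T : borel -> borel) (isMeasurableFun.Build _ _ borel borel T shift_measurable).
pose nu : probability borel R := distribution mu Tm.
exact: (@borel_probability_unique nu mu h A mA).
Qed.

End Borel.

Lemma integral_sum_indic d (T : measurableType d) (R : realType)
    (mu : {measure set T -> \bar R}) (I : Type) (s : seq I) (B : I -> set T) :
  (forall i, measurable (B i)) ->
  (\int[mu]_x (\sum_(i <- s) \1_(B i) x)%:E = \sum_(i <- s) mu (B i))%E.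
Proof.
move=> mB; under eq_integral do rewrite -sumEFin.
rewrite (@ge0_integral_sum _ _ _ mu setT measurableT _ (fun i x => (\1_(B i) x)%:E)).
- by apply: eq_bigr => i _; rewrite integral_indic // setIT.
- by move=> i; apply/measurable_EFinP; exact: measurable_indic.
- by move=> i x _; rewrite lee_fin.
Qed.

(** * Existence and uniqueness of the invariant measure, minimality *)

Section StrictlyErgodic.
Variables (R : realType) (L : finType) (fr : seq L -> R) (S : subshift L).
Hypothesis fr_nil : fr [::] = 1.
Hypothesis fr_ge0 : forall w, 0 <= fr w.
Hypothesis fr_rcons : forall w, \sum_a fr (rcons w a) = fr w.
Hypothesis fr_cons : forall w, \sum_a fr (a :: w) = fr w.
Hypothesis S_supported : forall x, subshift_set S x <-> supported fr x.

Local Notation X := (subshift_space S).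
Local Notation borel := (g_sigma_algebraType (@open X)).
Local Notation T := (@subshift_map L S).
Local Notation coded := (coded_itv fr).
Local Notation cyl := (@cylinder L S).

Lemma coding_map : exists Phi : R -> X, forall t, 0 <= t < 1 ->
  forall w, coded w t = (prefix_word (size w) (Phi t) == w).
Proof.
suff /choice[Phi hPhi] : forall t, exists x : X, 0 <= t < 1 ->
    forall w, coded w t = (prefix_word (size w) x == w) by exists Phi.
move=> t; have [ht|ht] := boolP (0 <= t < 1); last by exists point.
have [x [/S_supported sx hx]] := coding_exists fr_nil fr_ge0 fr_rcons fr_cons ht.
by exists (exist _ x (mem_set sx)).
Qed.

Lemma coded_itvE w : [set t | coded w t] = [set` `[left_end fr w, left_end fr w + fr w[].
Proof. by apply/seteqP; split=> t /=; rewrite in_itv /= /coded_itv. Qed.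

Lemma uniform_coded w : uniform_prob (@ltr01 R) [set t | coded w t] = (fr w)%:E.
Proof.
rewrite /uniform_prob (eq_integral (cst 1%E)); last first.
  move=> t /set_mem /= ht; rewrite /uniform_pdf.
  have /andP[h0 h1] := coded_bounds fr_nil fr_ge0 fr_rcons ht.
  by rewrite h0 (ltW h1) subr0 invr1.
rewrite coded_itvE integral_cst //= mul1e lebesgue_measure_itv /= lte_fin ltrDl.
case: ltP => h; first by rewrite -EFinB addrAC subrr add0r.
by congr EFin; apply/esym/eqP; rewrite eq_le h fr_ge0.
Qed.

Lemma frequency_measure : exists mu : probability borel R,
  forall w, mu (cyl w) = (fr w)%:E.
Proof.
have [Phi0 hPhi0] := coding_map.
(* Constant outside [0, 1), a null set for the uniform distribution, so that preimages of cylinders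
   are measurable: up to that null set, they are the coding intervals. *)
pose Phi t := if 0 <= t < 1 then Phi0 t else Phi0 0.
have preimE w : Phi @^-1` cyl w = [set t | coded w t] `|`
    (~` [set t | coded [::] t] `&` [set t | coded w 0]).
  have c1 t : coded [::] t = (0 <= t < 1) by rewrite /coded_itv /left_end /= fr_nil add0r.
  apply/seteqP; split=> t /=; rewrite c1 /Phi.
    case: ifPn => h /= e; first by left; rewrite hPhi0 //; apply/eqP.
    by right; split; [exact/negP|rewrite hPhi0 ?lexx ?ltr01 //; apply/eqP].
  case=> [h|[h1 h2]].
    have ht := coded_bounds fr_nil fr_ge0 fr_rcons h.
    by rewrite ht /cyl /=; apply/eqP; rewrite -hPhi0.
  by rewrite (negbTE (introN idP h1)) /cyl /=; apply/eqP; rewrite -hPhi0 ?lexx ?ltr01.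
have mcoded w : measurable [set t | coded w t] by rewrite coded_itvE; exact: measurable_itv.
have mconst (b : bool) : measurable [set t : R | b].
  by case: b; [rewrite (_ : [set _ | _] = setT) // | rewrite (_ : [set _ | _] = set0) //];
     apply/seteqP; split.
have mcyl w : measurable (Phi @^-1` cyl w).
  by rewrite preimE; apply: measurableU => //; apply: measurableI => //; exact: measurableC.
have mPhi : measurable_fun setT (Phi : measurableTypeR R -> borel).
  apply: (@measurability _ _ (measurableTypeR R) borel setT Phi _ (borel_cylinders S)).
  move=> _ [A [->|[w ->]] <-]; rewrite setTI ?preimage_set0 //; exact: mcyl.
pose Phim : {mfun measurableTypeR R >-> borel} :=
  HB.pack (Phi : measurableTypeR R -> borel)
    (isMeasurableFun.Build _ _ (measurableTypeR R) borel Phi mPhi).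
exists (distribution (uniform_prob (@ltr01 R)) Phim) => w.
rewrite /distribution /pushforward /= preimE.
set P := uniform_prob _; set N := ~` _ `&` _.
have mN : measurable N by apply: measurableI => //; exact: measurableC.
have N0 : P N = 0%E.
  apply/eqP; rewrite eq_le measure_ge0 andbT.
  apply: (@le_trans _ _ (P (~` [set t | coded [::] t]))).
    by apply: le_measure; [rewrite inE|rewrite inE; exact: (measurableC (mcoded [::]))|move=> t []].
  have P1 : P [set t | coded [::] t] = 1%E by rewrite -fr_nil; exact: uniform_coded.
  have -> : P (~` [set t | coded [::] t]) = (1 - P [set t | coded [::] t])%E.
    by apply: probability_setC; exact: mcoded.
  by rewrite P1 subee.
have Pw : P [set t | coded w t] = (fr w)%:E by exact: uniform_coded.
apply/eqP; rewrite eq_le; apply/andP; split.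
  apply: (@le_trans _ _ (P [set t | coded w t] + P N)%E).
    by apply: measureU2 => //; exact: mcoded.
  by rewrite Pw N0 adde0.
rewrite -Pw; apply: le_measure; [rewrite inE; exact: mcoded|rewrite inE|by move=> t; left].
by apply: measurableU => //; exact: mcoded.
Qed.

Hypothesis fr_uniform : forall w (e : R), 0 < e -> exists n0, forall n (x : nat -> L),
  (n0 <= n)%N -> supported fr x ->
  `|\sum_(i < n) (factor x i (size w) == w)%:R - n%:R * fr w| <= e * n%:R.

Lemma supported_val (x : X) : supported fr (\val x).
Proof. by apply/S_supported; exact: set_valP. Qed.

(** The number of visits to the cylinder during [n] steps is within [e * n] of [n * fr w] at every
    point, and its integral is [n] times the measure of the cylinder. *)
Lemma invariant_measure_cyl (nu : probability borel R) w :
  invariant_probability (T : X -> X) nu -> nu (cyl w) = (fr w)%:E.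
Proof.
move=> inv; have mT k : measurable (iter k T @^-1` cyl w : set borel).
  by apply: sub_sigma_algebra; apply: preimage_iter_open; exact: cyl_open.
have invk k : nu (iter k T @^-1` cyl w) = nu (cyl w).
  elim: k => [//|k IH]; rewrite -IH -[RHS]inv //; congr (nu _).
  by apply/seteqP; split=> x /=; rewrite -iterS iterSr.
have [c hc] : exists c : R, nu (cyl w) = c%:E.
  exists (fine (nu (cyl w))); rewrite fineK // ge0_fin_numE ?measure_ge0 //.
  by apply: (le_lt_trans (probability_le1 _ _)) (ltry _); exact: cyl_measurable.
rewrite hc; congr EFin; apply/eqP; rewrite -subr_eq0 -normr_le0; apply/ler_addgt0Pl => e e0.
rewrite addr0; have [n0 hn0] := fr_uniform w e0.
pose n := n0.+1; have n0R : 0 < n%:R :> R by [].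
pose h (x : X) : R := \sum_(i <- iota 0 n) \1_(iter i T @^-1` cyl w) x.
have hE x : h x = \sum_(i < n) (factor (\val x) i (size w) == w)%:R.
  rewrite /h -[iota 0 n]/(index_iota 0 n) big_mkord; apply: eq_bigr => i _.
  rewrite indicE; congr ((nat_of_bool _)%:R); rewrite -prefix_word_iter; apply/idP/eqP.
    by rewrite inE.
  by move=> e'; rewrite inE.
have hb x : `|h x - n%:R * fr w| <= e * n%:R.
  by rewrite hE; apply: hn0 => //; exact: supported_val.
have int_h : (\int[nu]_x (h x)%:E = (n%:R * c)%:E)%E.
  rewrite (integral_sum_indic nu _ mT) (eq_bigr (fun=> c%:E)); last first.
    by move=> i _; rewrite -hc -(invk i).
  by rewrite sumEFin big_const_seq count_predT size_iota iter_addr_0 mulr_natl.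
have h0 x : 0 <= h x by apply: sumr_ge0 => i _; rewrite indicE.
have mh : measurable_fun setT (fun x : borel => (h x)%:E).
  apply/measurable_EFinP; apply: measurable_sum => i; exact: measurable_indic.
have int_c a : (\int[nu]_x (cst a%:E x) = a%:E)%E.
  by rewrite integral_cst //= probability_setT mule1.
have up : n%:R * c <= n%:R * fr w + e * n%:R.
  rewrite -lee_fin -int_h -int_c; apply: ge0_le_integral => //.
  - by move=> x _; rewrite lee_fin.
  - by move=> x _; rewrite lee_fin; move: (hb x); rewrite ler_norml; lra.
(* The maximum with 0 keeps the smaller integrand nonnegative, as [ge0_le_integral] demands. *)
have lo : Num.max 0 (n%:R * fr w - e * n%:R) <= n%:R * c.
  rewrite -lee_fin -int_h -int_c; apply: ge0_le_integral => //.
  - by move=> x _; rewrite lee_fin le_max lexx.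
  - move=> x _; rewrite lee_fin ge_max h0 /=; move: (hb x); rewrite ler_norml; lra.
move: lo; rewrite ge_max => /andP[_ lo].
rewrite -(ler_pM2l n0R) -{1}(gtr0_norm n0R) -normrM mulrBr ler_norml.
by apply/andP; split; lra.
Qed.

Lemma fr_uniquely_ergodic : uniquely_ergodic R (T : X -> X).
Proof.
have [mu hmu] := frequency_measure; exists mu; last first.
  move=> nu inv; apply: borel_probability_unique => w.
  by rewrite invariant_measure_cyl.
apply: invariant_of_cyl => w; rewrite hmu -fr_cons.
have mT : measurable (T @^-1` cyl w : set borel).
  by apply: sub_sigma_algebra; apply: (@preimage_iter_open _ _ 1); exact: cyl_open.
rewrite -[T @^-1` _]setIT -integral_indic //.
(* The preimage of [cyl w] is the disjoint union of the [cyl (a :: w)], so on cylinders invariance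
   amounts to [fr_cons]. *)
have e x : (\1_(T @^-1` cyl w) x = \sum_(a : L) \1_(cyl (a :: w)) x :> R).
  rewrite (bigD1 ((\val x) 0%N)) //= big1 ?addr0 => [|a ha].
    have pT : prefix_word (size w) (T x) = factor (\val x) 1 (size w).
      exact: (prefix_word_iter (size w) 1 x).
    rewrite !indicE; congr ((nat_of_bool _)%:R); apply/idP/idP; rewrite !inE.
      by move=> h; rewrite /cylinder /= -[in RHS]h pT.
    by rewrite /cylinder /= pT => -[].
  rewrite indicE memNset // /cylinder /= => -[e _]; by rewrite -e eqxx in ha.
under eq_integral do rewrite e.
rewrite integral_sum_indic; last by move=> a; exact: cyl_measurable.
by rewrite -sumEFin; apply: eq_bigr => a _; exact: hmu.
Qed.

(** By uniformity, the orbit of any point of [F] visits every cylinder of positive frequency, and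
    all cylinders around points of the subshift are such. *)
Lemma fr_minimal : minimal_system (T : X -> X).
Proof.
move=> F cF [x Fx] TF; rewrite -subTset => z _; apply: cF => U /nbhs_subshiftP[n hn].
pose w := prefix_word n z; have sw : size w = n by exact: size_prefix_word.
have fw : 0 < fr w by exact: (supported_val z 0%N n).
have [n0 hn0] := fr_uniform w (divr_gt0 fw (ltr0n R 2)).
have := hn0 n0.+1 _ (leqnSn _) (supported_val x); rewrite sw.
have n0R : 0 < n0.+1%:R :> R by [].
have [/existsP[i /eqP hi] _|/existsPn no] :=
  boolP [exists i : 'I_n0.+1, factor (\val x) i n == w].
  exists (iter i T x); split; last by apply: hn; rewrite /= prefix_word_iter.
  elim: (val i) => [//|k IH]; apply: TF; exists (iter k T x) => //.
rewrite big1 => [|i _]; last by rewrite (negbTE (no i)).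
rewrite sub0r normrN mulrC normrM (gtr0_norm fw) (gtr0_norm n0R) ler_pM2r //; lra.
Qed.

Lemma fr_strictly_ergodic : strictly_ergodic R (T : X -> X).
Proof. split; [exact: fr_uniquely_ergodic|exact: fr_minimal]. Qed.

End StrictlyErgodic.

(** * Entropy *)

Section Fekete.
Variables (R : realType) (a : nat -> R).
Hypothesis a0 : forall n, 0 <= a n.
Hypothesis aD : forall m n, a (m + n)%N <= a m + a n.

Lemma subadditive_mul_add m q r : a (q * m + r)%N <= q%:R * a m + a r.
Proof.
elim: q => [|q IH]; first by rewrite mul0n add0n mul0r add0r.
rewrite mulSn -addnA; apply: (le_trans (aD _ _)).
by rewrite -natr1 mulrDl mul1r [_ + a m]addrC -addrA lerD2l.
Qed.

(** The limit is the infimum of a_n / n over n >= 1. Convergence matters because the [lim] in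
    [cover_entropy] would otherwise be a default value. *)
Lemma fekete_cvg : cvg (n%:R^-1 * a n @[n --> \oo]).
Proof.
pose E := [set n.+1%:R^-1 * a n.+1 | n in [set: nat]].
have E0 : has_inf E.
  split; first by exists (1%:R^-1 * a 1%N), 0%N.
  by exists 0 => _ [n _ <-]; rewrite mulr_ge0.
apply/cvg_ex; exists (inf E); apply/cvgrPdist_le => e e0.
have e2 : 0 < e / 2 by rewrite divr_gt0.
have [_ [m _ <-] hm] := inf_adherent e2 E0.
pose B := \sum_(i < m.+1) a i.
have hB r : (r < m.+1)%N -> a r <= B.
  move=> h; rewrite /B (bigD1 (Ordinal h)) //= lerDl sumr_ge0 //.
exists (Num.truncn (B / (e / 2))).+1 => // n /= hn.
have n0 : 0 < n%:R :> R by rewrite ltr0n (leq_trans _ hn).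
have lo : inf E <= n%:R^-1 * a n.
  apply: ge_inf; first by case: E0.
  by case: (n) n0 => [|n' _]; [rewrite ltxx|exists n'].
have hBn : B <= e / 2 * n%:R.
  rewrite mulrC -ler_pdivrMr //; apply: (le_trans (ltW (truncnS_gt _))).
  by rewrite ler_nat.
have up : a n <= (inf E + e) * n%:R.
  rewrite {1}(divn_eq n m.+1); apply: (le_trans (subadditive_mul_add _ _ _)).
  have hr := hB _ (ltn_pmod n (ltn0Sn m)).
  have m0 : 0 < m.+1%:R :> R by [].
  have am : a m.+1 <= (inf E + e / 2) * m.+1%:R.
    by move: hm; rewrite mulrC ltr_pdivrMr // => /ltW.
  have hq : (n %/ m.+1)%:R * m.+1%:R <= n%:R :> R.
    by rewrite -natrM ler_nat leq_divM.
  have iE : 0 <= inf E + e / 2.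
    by move: am; have := a0 m.+1 => h1 h2; rewrite -(pmulr_lge0 _ m0) (le_trans h1).
  have h1 := ler_wpM2l (ler0n R (n %/ m.+1)) am.
  have h2 := ler_wpM2l iE hq.
  rewrite mulrCA in h1; lra.
rewrite distrC ger0_norm ?subr_ge0 // lerBlDl mulrC ler_pdivrMr //.
Qed.

End Fekete.

Section CoveringNumber.
Variables (R : realType) (X : ptopologicalType).
Implicit Types (C : set (set X)).

Lemma covering_number_le (J : eqType) (s : seq J) (h : J -> set X) C :
  (forall j, j \in s -> C (h j)) -> (forall x, exists2 j, j \in s & h j x) ->
  covering_number R C <= (size s)%:R.
Proof.
move=> hC hcov.
pose V := [set h j | j in [set j | j \in s]].
have Vs : (V #<= `I_(size s))%card.
  have [j0 _ _] := hcov point.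
  have sub : V `<=` [set h (nth j0 s i) | i in `I_(size s)].
    by move=> _ [j /= js <-]; exists (index j s) => /=; rewrite ?index_mem ?nth_index.
  apply: (@card_le_trans _ _ _ [set h (nth j0 s i) | i in `I_(size s)]).
    exact: subset_card_le.
  exact: card_image_le.
have [k Vk] : exists k, (V #= `I_k)%card.
  by apply/finite_setP; apply: card_le_finite Vs _; exact: finite_II.
have ks : (k <= size s)%N.
  rewrite -card_le_II; apply: card_le_trans Vs; by move: Vk; rewrite card_eq_le => /andP[].
apply: (@le_trans _ _ k%:R); last by rewrite ler_nat.
apply: ge_inf; first by exists 0 => _ [j _ <-].
exists k => //; exists V; split=> //.
  by move=> _ [j /= /hC ? <-].
rewrite -subTset => x _; have [j js hx] := hcov x.
by exists (h j) => //; exists j.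
Qed.

(** Points that no member of [C] contains in pairs need as many members. The finite cover [V0]
    ensures that the infimum is not over the empty set. *)
Lemma covering_number_ge (J : eqType) (s : seq J) (f : J -> X) C (V0 : set (set X)) k0 :
  V0 `<=` C -> (V0 #= `I_k0)%card -> \bigcup_(A in V0) A = setT ->
  uniq s ->
  (forall i j A, i \in s -> j \in s -> C A -> A (f i) -> A (f j) -> i = j) ->
  (size s)%:R <= covering_number R C.
Proof.
move=> V0C V0k V0T us sep; apply: lb_le_inf; first by exists k0%:R, k0 => //; exists V0.
move=> _ [k [V [VC Vk VT]] <-]; rewrite ler_nat -card_le_II.
case: s us sep => [|j0 s'] us sep; first by rewrite card_le_II.
set s := j0 :: s' in us sep *.
have hA j : exists A, V A /\ A (f j).
  by have : [set: X] (f j) by []; rewrite -VT => -[A VA Af]; exists A.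
have /choice[A hAV] := hA.
have inj : {in `I_(size s) &, injective (fun i => A (nth j0 s i))}.
  move=> i i' /set_mem hi /set_mem hi' e.
  have [VA1 A1] := hAV (nth j0 s i); have [_ A2] := hAV (nth j0 s i').
  apply/eqP; rewrite -(nth_uniq j0 (hi : (i < size s)%N) (hi' : (i' < size s)%N) us); apply/eqP.
  by apply: (sep _ _ (A (nth j0 s i))); rewrite ?mem_nth //; [exact: VC|rewrite e].
have /card_eqPle[_ le1] := inj_card_eq inj.
apply: (card_le_trans le1); move: Vk => /card_eqPle[Vk _]; apply: card_le_trans Vk.
by apply: subset_card_le => _ [i _ <-]; case: (hAV (nth j0 s i)).
Qed.

End CoveringNumber.

Lemma cvg_invn (R : realType) : n%:R^-1 @[n --> \oo] --> (0 : R).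
Proof.
apply/cvgrPdist_le => e e0; exists (Num.truncn e^-1).+1 => // n /= hn.
have n0 : 0 < n%:R :> R by rewrite ltr0n (leq_trans _ hn).
rewrite sub0r normrN ger0_norm ?invr_ge0 // invf_ple ?posrE //.
by apply: (le_trans (ltW (truncnS_gt _))); rewrite ler_nat.
Qed.

Section EntropyUpper.
Variables (R : realType) (L : finType) (S : subshift L).
Local Notation X := (subshift_space S).
Local Notation T := (@subshift_map L S).

Lemma card_alphabet_gt0 : (0 < #|L|)%N.
Proof. by apply/card_gt0P; exists (\val (point : X) 0%N). Qed.

Lemma covering_number_join_le (U : set (set X)) s n :
  (forall x : X, exists2 A, U A & [set x' | prefix_word s x' = prefix_word s x] `<=` A) ->
  covering_number R (iterated_join (T : X -> X) U n) <= (#|L| ^ (n + s))%:R.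
Proof.
move=> hU.
have /choice[A hA] : forall x : X, exists A, U A /\ [set x' | prefix_word s x' = prefix_word s x] `<=` A.
  by move=> x; have [A UA h] := hU x; exists A.
(* The first [n + s] letters determine, for each [i < n], the [s] letters seen from time [i], hence
   a member of [U] containing that shifted point; [rep] picks one point per word, arbitrary for
   words that do not occur. *)
have /choice[rep hrep] : forall w : (n + s).-tuple L, exists x0 : X,
    forall x : X, prefix_word (n + s) x = w -> prefix_word (n + s) x0 = w.
  move=> w; have [[x hx]|no] := pselect (exists x : X, prefix_word (n + s) x = w).
    by exists x.
  by exists point => x hx; case: no; exists x.
pose h (w : (n + s).-tuple L) : set X := \bigcap_(i < n) (iter i T @^-1` A (iter i T (rep w))).
rewrite -card_tuple cardE; apply: (@covering_number_le R X _ _ h) => [w _|x].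
  exists (fun i => A (iter i T (rep w))) => //= i; exact: (hA _).1.
have sx : size (prefix_word (n + s) x) == (n + s)%N by rewrite size_prefix_word.
exists (Tuple sx); first by rewrite mem_enum.
move=> i /= hi; apply: (hA _).2 => /=; rewrite !prefix_word_iter.
have hs : (i + s <= n + s)%N by rewrite leq_add2r ltnW.
have /= /(congr1 (fun w => take s (drop i w))) := hrep (Tuple sx) x erefl.
by rewrite /prefix_word !take_drop_factor // !add0n => ->.
Qed.

Lemma cover_entropy_le (U : set (set X)) : open_cover U ->
  cover_entropy R (T : X -> X) U <= ln #|L|%:R.
Proof.
move=> oU; rewrite /cover_entropy.
have L1 : (1 : R) <= #|L|%:R by rewrite ler1n card_alphabet_gt0.
have L0 : (0 : R) < #|L|%:R by exact: lt_le_trans L1.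
have lnL : 0 <= ln #|L|%:R :> R by exact: ln_ge0.
have [s hs] := lebesgue_number oU.
set u := fun n => _.
(* The [lim] of a divergent sequence is the default point 0. *)
have [cu|/dvgP ->] := pselect (cvg (u @ \oo)); last exact: lnL.
have ub n : u n <= ln #|L|%:R + n%:R^-1 * (s%:R * ln #|L|%:R).
  rewrite /u; case: n => [|n]; first by rewrite invr0 !mul0r addr0.
  have n0 : 0 < n.+1%:R :> R by [].
  have -> : ln #|L|%:R + n.+1%:R^-1 * (s%:R * ln #|L|%:R) =
     n.+1%:R^-1 * ln ((#|L| ^ (n.+1 + s))%:R) :> R.
    rewrite natrX lnXn // -[ln _ *+ _]mulr_natl natrD; field.
    by rewrite nat1r.
  rewrite ler_wpM2l ?invr_ge0 //.
  have := covering_number_join_le n.+1 hs; set c := covering_number _ _ => hc.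
  have [c0|c0] := ltP 0 c; first by rewrite ler_ln ?posrE // (lt_le_trans c0 hc).
  by rewrite (ln0 c0) ln_ge0 // ler1n expn_gt0 card_alphabet_gt0.
have cv : (fun n => ln #|L|%:R + n%:R^-1 * (s%:R * ln #|L|%:R)) @ \oo -->
    ln #|L|%:R + (0 : R) * (s%:R * ln #|L|%:R).
  apply: cvgD; first exact: cvg_cst.
  apply: cvgM; last exact: cvg_cst.
  exact: cvg_invn.
rewrite mul0r addr0 in cv.
rewrite -(cvg_lim (@Rhausdorff R) cv); apply: ler_lim => //; last exact: nearW.
by apply/cvg_ex; eexists; exact: cv.
Qed.

End EntropyUpper.

Section EntropyLower.
Variables (R : realType) (L : finType) (fr : seq L -> R) (S : subshift L).
Hypothesis fr_nil : fr [::] = 1.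
Hypothesis fr_ge0 : forall w, 0 <= fr w.
Hypothesis fr_rcons : forall w, \sum_a fr (rcons w a) = fr w.
Hypothesis fr_cons : forall w, \sum_a fr (a :: w) = fr w.
Hypothesis S_supported : forall x, subshift_set S x <-> supported fr x.
Local Notation X := (subshift_space S).
Local Notation T := (@subshift_map L S).

Definition language (n : nat) : seq (seq L) :=
  [seq val t | t <- enum [pred t : n.-tuple L | 0 < fr t]].

Lemma size_language n : size (language n) = #|[pred t : n.-tuple L | 0 < fr t]|.
Proof. by rewrite size_map -cardE. Qed.

Lemma language_uniq n : uniq (language n).
Proof. by rewrite map_inj_uniq ?enum_uniq //; exact: val_inj. Qed.

Lemma mem_language n w : (w \in language n) = (size w == n) && (0 < fr w).
Proof.
apply/mapP/andP => [[t]|[sw fw]].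
  by rewrite mem_enum inE => ft ->; rewrite size_tuple.
by exists (Tuple sw); rewrite ?mem_enum.
Qed.

Lemma prefix_in_language n (x : X) : prefix_word n x \in language n.
Proof.
rewrite mem_language size_prefix_word eqxx /=.
by apply: (proj1 (S_supported _)); exact: set_valP.
Qed.

(** The interval of a positive word is nonempty, and its left endpoint codes a point with that
    prefix. *)
Lemma language_prefix n w : w \in language n -> exists x : X, prefix_word n x = w.
Proof.
rewrite mem_language => /andP[/eqP sw fw].
have cw : coded_itv fr w (left_end fr w) by rewrite /coded_itv lexx ltrDl.
have [x [sx hx]] := coding_exists fr_nil fr_ge0 fr_rcons fr_cons
  (coded_bounds fr_nil fr_ge0 fr_rcons cw).
exists (exist _ x (mem_set (proj2 (S_supported x) sx))).
by move: cw; rewrite hx -sw => /eqP.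
Qed.

Lemma fr_take_le u v : fr (u ++ v) <= fr u.
Proof.
elim/last_ind: v => [|v a IH]; first by rewrite cats0.
by apply: le_trans IH; rewrite -rcons_cat -[leRHS]fr_rcons (bigD1 a) //= lerDl sumr_ge0.
Qed.

Lemma size_language_add m n :
  (size (language (m + n)) <= size (language m) * size (language n))%N.
Proof.
rewrite -(size_allpairs cat); apply: uniq_leq_size; first exact: language_uniq.
move=> w; rewrite mem_language => /andP[/eqP sw fw].
have e : w = take m w ++ drop m w by rewrite cat_take_drop.
apply/allpairsP; exists (take m w, drop m w); split=> //=; rewrite mem_language.
  rewrite size_takel ?sw ?leq_addr // eqxx; apply: lt_le_trans fw _.
  by rewrite [in leLHS]e fr_take_le.
rewrite size_drop sw addKn eqxx; apply: lt_le_trans fw _.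
by rewrite [in leLHS]e fr_cat_le.
Qed.

Lemma size_language_gt0 n : (0 < size (language n))%N.
Proof. by have := prefix_in_language n point; case: language. Qed.

(** A cover by disjoint cylinders, so the covering numbers of its joins count exactly the words of
    the language. *)
Definition letter_cover : set (set X) := [set cylinder [:: a] | a in [set: L]].

Lemma letter_cover_open : open_cover letter_cover.
Proof.
split; first by move=> _ [a _ <-]; exact: cyl_open.
by rewrite -subTset => x _; exists (cylinder [:: \val x 0%N]) => //; exists (\val x 0%N).
Qed.

Lemma cyl_letter a (x : X) : cylinder [:: a] x <-> \val x 0%N = a.
Proof. by split=> [[]|<-]. Qed.

Lemma join_letter_sep n A (x x' : X) : iterated_join (T : X -> X) letter_cover n A ->
  A x -> A x' -> prefix_word n x = prefix_word n x'.
Proof.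
move=> [W hW <-] h h'; apply/factor_eqP => i hi; rewrite add0n.
have [a _ e] := hW i.
have coord (z : X) : \val (iter i T z) 0%N = \val z i.
  have := prefix_word_iter 1 i z; by case.
have := h i hi; have := h' i hi; rewrite -e /= !cyl_letter !coord.
by move=> -> ->.
Qed.

Lemma join_letter_cyl n w : size w = n -> iterated_join (T : X -> X) letter_cover n (cylinder w).
Proof.
move=> sw; have [a0 _] : exists a0 : L, True by exists (\val (point : X) 0%N).
exists (fun i => cylinder [:: nth a0 w i]); first by move=> i; exists (nth a0 w i).
have coord i (z : X) : \val (iter i T z) 0%N = \val z i.
  have := prefix_word_iter 1 i z; by case.
apply/seteqP; split=> x.
  move=> h; apply: (@eq_from_nth _ a0); rewrite size_prefix_word // sw => i hi.
  have := h i hi; rewrite /= cyl_letter coord => <-.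
  by rewrite (nth_map 0%N) ?size_iota // nth_iota.
move=> xw i /= hi; rewrite cyl_letter coord -[in RHS]xw.
by rewrite (nth_map 0%N) ?size_iota ?sw // nth_iota ?sw.
Qed.

Lemma covering_number_letters n :
  covering_number R (iterated_join (T : X -> X) letter_cover n) = (size (language n))%:R.
Proof.
have mem w : w \in language n -> size w = n by rewrite mem_language => /andP[/eqP].
apply/eqP; rewrite eq_le; apply/andP; split.
  apply: (@covering_number_le R X _ _ (@cylinder L S)) => [w /mem|x].
    exact: join_letter_cyl.
  by exists (prefix_word n x); [exact: prefix_in_language|rewrite /cylinder /= size_prefix_word].
have /choice[f hf] : forall w, exists x : X, w \in language n -> prefix_word n x = w.
  move=> w; have [/language_prefix[x hx]|_] := boolP (w \in language n); last by exists point.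
  by exists x.
pose V0 : set (set X) := [set cylinder w | w in [set w | w \in language n]].
have V0f : finite_set V0.
  by apply: finite_image; exact: finite_seq.
have [k0 V0k] : exists k0, (V0 #= `I_k0)%card by apply/finite_setP.
apply: (@covering_number_ge R X _ _ f _ V0 k0) => //.
- by move=> _ [w /= /mem sw <-]; exact: join_letter_cyl.
- rewrite -subTset => x _; exists (cylinder (prefix_word n x)); last by rewrite /cylinder /= size_prefix_word.
  by exists (prefix_word n x) => //; exact: prefix_in_language.
- exact: language_uniq.
- by move=> v w A hv hw hA h1 h2; rewrite -(hf v hv) -(hf w hw); exact: join_letter_sep hA h1 h2.
Qed.

(** A bound for arbitrarily large [n] is enough, since [fekete_cvg] makes the whole sequence
    converge. *)
Lemma topological_entropy_ge (c : R) :
  (forall n0, exists2 n, (n0 <= n)%N & n%:R * c <= ln (size (language n))%:R) ->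
  (c%:E <= topological_entropy R (T : X -> X))%E.
Proof.
move=> hc; apply: (@le_trans _ _ (cover_entropy R (T : X -> X) letter_cover)%:E); last first.
  by apply: ereal_sup_ubound; exists letter_cover => //; exact: letter_cover_open.
rewrite lee_fin /cover_entropy.
under [X in lim (X @ _)]funext do rewrite covering_number_letters.
pose a n : R := ln (size (language n))%:R.
have p0 n : 0 < (size (language n))%:R :> R by rewrite ltr0n size_language_gt0.
have a0 n : 0 <= a n by rewrite ln_ge0 // ler1n size_language_gt0.
have aD m n : a (m + n)%N <= a m + a n.
  by rewrite /a -lnM ?posrE // ler_ln ?posrE ?mulr_gt0 // -natrM ler_nat size_language_add.
have ca := fekete_cvg a0 aD.
set l := lim _; rewrite leNgt; apply/negP => lc.
have := ca => /cvgrPdist_lt /(_ (c - l)); rewrite subr_gt0 => /(_ lc)[n0 _ hn0].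
have [n hn hcn] := hc (maxn n0 1).
have /= := hn0 n (leq_trans (leq_maxl _ _) hn).
have n1 : 0 < n%:R :> R by rewrite ltr0n (leq_trans (leq_maxr _ _) hn).
have : c <= n%:R^-1 * a n by rewrite mulrC ler_pdivlMr // mulrC.
rewrite -/l ltr_norml => h1 /andP[h2 _]; lra.
Qed.

Lemma topological_entropy_close (eps : R) : 0 < eps ->
  (forall n0, exists2 n, (n0 <= n)%N &
     n%:R * (ln #|L|%:R - eps / 2) <= ln (size (language n))%:R) ->
  (`| topological_entropy R (T : X -> X) - (ln (#|L|%:R : R))%:E | < eps%:E)%E.
Proof.
move=> e0 /topological_entropy_ge lo.
have up : (topological_entropy R (T : X -> X) <= (ln #|L|%:R : R)%:E)%E.
  by apply: ge_ereal_sup => _ [U oU <-]; rewrite lee_fin; exact: cover_entropy_le.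
move: lo up; case: topological_entropy => [h| |] //.
rewrite !lee_fin => lo up; rewrite -EFinB /= lte_fin ltr_norml.
by apply/andP; split; lra.
Qed.

End EntropyLower.

(** * From words to continuous functions *)

Section Uncorrelated.
Variables (R : realType) (L : finType) (fr : seq L -> R) (S : subshift L) (y : nat -> R).
Hypothesis S_supported : forall x, subshift_set S x <-> supported fr x.
Hypothesis y_bounded : exists M : R, forall n, (1 <= n)%N -> `|y n| <= M.
Hypothesis words_uncorrelated : forall w (e : R), 0 < e -> exists n0,
  forall n (x : nat -> L), (n0 <= n)%N -> supported fr x ->
    `|\sum_(i < n) y i.+1 * (factor x i (size w) == w)%:R| <= e * n%:R.
Local Notation X := (subshift_space S).
Local Notation T := (@subshift_map L S).

Lemma subshift_uncorrelated : uniformly_uncorrelated (T : X -> X) y.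
Proof.
move=> f cf e e0; have [M hM] := y_bounded.
have M0 : 0 <= M by apply: le_trans (hM 1%N isT).
(* [f] is replaced, up to [d], by a combination of indicators of words of length [s]; [d] here and
   [e'] below are chosen so that each contributes at most [e / 4]. *)
pose d := e / (4 * (M + 1)).
have d0 : 0 < d by rewrite divr_gt0 // mulr_gt0 //; lra.
have [s hs] := subshift_uniform_continuity cf d0.
have /choice[c hc] : forall w : s.-tuple L, exists c : R,
    forall x, prefix_word s x = w -> `|f x - c| <= d.
  move=> w; have [[x0 hx0]|no] := pselect (exists x : X, prefix_word s x = w).
    by exists (f x0) => x hx; apply: hs; rewrite hx0.
  by exists 0 => x hx; case: no; exists x.
pose C := 1 + \sum_w `|c w|.
have C0 : 0 < C by rewrite ltr_pwDl // sumr_ge0.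
pose e' := e / (4 * C).
have e'0 : 0 < e' by rewrite divr_gt0 // mulr_gt0.
have /choice[N hN] : forall w : s.-tuple L, exists n0, forall n (x : nat -> L),
    (n0 <= n)%N -> supported fr x ->
    `|\sum_(i < n) y i.+1 * (factor x i s == w)%:R| <= e' * n%:R.
  by move=> w; have [n0 h] := words_uncorrelated w e'0; exists n0 => n x; have := h n x; rewrite size_tuple.
exists (\max_w N w).+1 => n hn x.
have n0 : 0 < n%:R :> R by rewrite ltr0n (leq_trans _ hn).
rewrite normrM normfV (gtr0_norm n0) mulrC ltr_pdivrMr //.
rewrite -{1}[1%N]add0n big_addn subn1 /= big_mkord.
(* The averages start at time 1, whereas the estimates on words start at 0. *)
pose x' := T x.
have sx' : supported fr (\val x') by apply/S_supported; exact: set_valP.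
pose g (i : nat) : R := \sum_(w : s.-tuple L) c w * (factor (\val x') i s == w)%:R.
have fg i : `|f (iter i T x') - g i| <= d.
  have sw : size (factor (\val x') i s) == s by rewrite size_factor.
  rewrite /g (bigD1 (Tuple sw)) //= eqxx mulr1 big1 ?addr0 => [|w hw].
    by apply: hc; rewrite prefix_word_iter.
  by rewrite eq_sym (_ : (_ == _) = false) ?mulr0 //; apply: negbTE; move: hw.
have -> : \sum_(i < n) f (iter (i + 1) T x) * y (i + 1)%N =
    \sum_(i < n) (f (iter i T x') - g i) * y i.+1 + \sum_(i < n) g i * y i.+1.
  rewrite -big_split /=; apply: eq_bigr => i _.
  by rewrite -mulrDl subrK addn1 iterSr.
have h1 : `|\sum_(i < n) (f (iter i T x') - g i) * y i.+1| <= d * M * n%:R.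
  apply: (le_trans (ler_norm_sum _ _ _)).
  rewrite mulr_natr -[X in _ *+ X](card_ord n) -sumr_const; apply: ler_sum => i _.
  by rewrite normrM ler_pM // hM.
have h2 : `|\sum_(i < n) g i * y i.+1| <= (\sum_w `|c w|) * (e' * n%:R).
  have -> : \sum_(i < n) g i * y i.+1 =
      \sum_w c w * \sum_(i < n) y i.+1 * (factor (\val x') i s == w)%:R.
    under eq_bigr do rewrite mulr_suml.
    rewrite exchange_big /=; apply: eq_bigr => w _; rewrite mulr_sumr.
    by apply: eq_bigr => i _; rewrite -mulrA [_%:R * _]mulrC.
  apply: (le_trans (ler_norm_sum _ _ _)); rewrite mulr_suml; apply: ler_sum => w _.
  rewrite normrM ler_wpM2l //; apply: hN => //.
  by apply: leq_trans (ltnW hn); exact: leq_bigmax.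
apply: (le_lt_trans (ler_normD _ _)); apply: (le_lt_trans (lerD h1 h2)).
have g1 : d * M <= e / 4.
  rewrite /d -mulrA; have -> : e / 4 = e / (4 * (M + 1)) * (M + 1).
    by field; rewrite gt_eqF //; lra.
  by rewrite mulrA ler_wpM2l ?(ltW d0) //; lra.
have g2 : (\sum_w `|c w|) * e' <= e / 4.
  have -> : e / 4 = C * e' by rewrite /e'; field; rewrite gt_eqF.
  by rewrite ler_wpM2r ?(ltW e'0) // /C lerDr.
have h3 := ler_wpM2r (ltW n0) g1; have h4 := ler_wpM2r (ltW n0) g2.
have h5 : 0 < e * n%:R by rewrite mulr_gt0.
rewrite mulrA; lra.
Qed.

End Uncorrelated.

Unset Implicit Arguments.
Set Strict Implicit.
Set Printing Implicit Defensive.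

Theorem theorem2p2 (R : realType) (y : nat -> R) (hy : aperiodic y)
    (N : nat) (hN : (2 <= N)%N) (eps : R) (heps : 0 < eps) :
  exists S : subshift 'I_N,
    [/\ strictly_ergodic R (@subshift_map 'I_N S),
        (`| topological_entropy R (@subshift_map 'I_N S) - (ln (N%:R : R))%:E |
           < eps%:E)%E &
        uniformly_uncorrelated (@subshift_map 'I_N S) y].
Proof.
have N0 : (0 < #|'I_N|)%N by rewrite card_ord (leq_trans _ hN).
(* Half of [eps] leaves room for the strict inequality. *)
have [fr [[fr1 fr0 frr frc] [unif unc grow]]] :=
  symbolic_core hy N0 (divr_gt0 heps (ltr0n R 2)).
have [S hS] := exists_subshift fr1 fr0 frr frc.
exists S; split.
- exact: (fr_strictly_ergodic fr1 fr0 frr frc hS unif).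
- rewrite -[in ln _](card_ord N).
  apply: (topological_entropy_close fr1 fr0 frr frc hS heps) => n0.
  by have [n hn h] := grow n0; exists n => //; rewrite size_language.
- exact: (subshift_uncorrelated hS hy.1 unc).
Qed.
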